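(* Let $C$ and $D$ be generators of the $lC_0$-semigroups $\exp(sC)$ and $\exp(sD)$ in a complete (Hausdorff) locally convex space $\mathbf{X}$ and let $t>0$ be fixed. Put $F(s)=\exp(sC)\exp(sD)$, $s\ge0$. Assume that: (i) $\mathcal{D}(C)\cap\mathcal{D}(D)$ is dense in $\mathbf{X}$; (ii) $F\in\mathcal{E}_{\mathbf{X}}$. Then the sum of $C$ and $D$ possesses a closure and its closure is the generator of an $lC_0$-semigroup if and only if there exists a dense linear subspace $\mathbf{A}\subseteq\mathcal{D}(C)\cap\mathcal{D}(D)$ of $\mathbf{X}$ such that for any $f\in\mathbf{A}$ and $s\ge0$ there exists a sequence $\{f_n^s\}_{n=1}^\infty$, $f_n^s\in\mathcal{D}(\overline{C+D})$, satisfying the following conditions: (a) $w\text{-}\lim_{n\to\infty}\left((\exp(\tfrac tnC)\exp(\tfrac tnD))^{[ns]}f-f_n^s\right)=0$; (b) every subsequence of the sequence $\{F(\tfrac tn)^{[ns/t]}f\}_{n\in\mathbb{N}}$ has a convergent subsequence; (c) every subsequence of the sequence $\{(\overline{C+D})f_n^s\}_{n=1}^\infty$ has a weakly convergent subsequence. Furthermore, if conditions (a)–(c) are satisfied (for such a subspace $\mathbf{A}$), then for each $f\in\mathbf{X}$ $$\exp(s(\overline{C+D}))f=\lim_{n\to\infty}\left(\exp(\tfrac snC)\exp(\tfrac snD)\right)^nf,\quad s>0.$$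
   Context: $\mathbf{X}$ is over $\mathbb{T}\in\{\mathbb{R},\mathbb{C}\}$ with topology generated by semi-norms $\|\cdot\|_\alpha$, $\alpha\in\Omega$. $\mathcal{L}(\mathbf{X})$ is the space of bounded linear operators in $\mathbf{X}$ with the topology of pointwise convergence; $I$ is the identity; $\mathcal{D}(\cdot)$ denotes domain; $[\cdot]$ is the integer part; $w\text{-}\lim$ is the limit in the weak topology $\sigma(\mathbf{X},\mathbf{X}^* )$. A family $G_\beta\in\mathcal{L}(\mathbf{X})$, $\beta\in\Gamma$, is equicontinuous if for any $\alpha\in\Omega$ there are finitely many $\alpha_1,\dots,\alpha_n\in\Omega$ and $b_1,\dots,b_n>0$ with $\sup_\beta\|G_\beta x\|_\alpha\le\sum_i b_i\|x\|_{\alpha_i}$ for all $x\in\mathbf{X}$. For $F:[0,\infty)\to\mathcal{L}(\mathbf{X})$ and $s\ge0$ put $\mathbf{B}^F_s=\{F(\tfrac dn)^m : md/n\le s,\ n,m\in\mathbb{N},\ d\ge0\}$. $\mathcal{E}_{\mathbf{X}}$ is the set of $F:[0,\infty)\to\mathcal{L}(\mathbf{X})$ with $F(0)=I$ and $\mathbf{B}^F_s$ equicontinuous for every $s\ge0$. An $lC_0$-semigroup is a continuous function $T:[0,\infty)\to\mathcal{L}(\mathbf{X})$ with $T(0)=I$, $T(l+m)=T(l)T(m)$ for $l,m\ge0$, and $T\in\mathcal{E}_{\mathbf{X}}$. Its generator is the operator $Z\psi=\lim_{h\to0}h^{-1}(T(h)\psi-\psi)$ with domain the set of all $\psi$ for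 which the limit exists; one writes $T(t)=\exp(tZ)$. $C+D$ has domain $\mathcal{D}(C)\cap\mathcal{D}(D)$. A linear operator is closable (possesses a closure) if the closure of its graph in $\mathbf{X}\times\mathbf{X}$ is the graph of a linear operator, its closure, denoted by an overline; under hypotheses (i)–(ii) $C+D$ is closable. *)

(* Defs.v *)
From HB Require Import structures.
From mathcomp Require Import all_boot all_order all_algebra.
From mathcomp Require Import all_classical all_reals.
From mathcomp Require Import topology normedtype.
From mathcomp.real_closed Require Import complex.

Set Implicit Arguments.
Unset Strict Implicit.
Unset Printing Implicit Defensive.

Import Order.TTheory GRing.Theory Num.Theory.
Import numFieldTopology.Exports numFieldNormedType.Exports.

Local Open Scope classical_set_scope.
Local Open Scope ring_scope.
Local Open Scope complex_scope.

Inductive scalar_kind := RealScalars | ComplexScalars.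

Definition scalars (R : realType) (k : scalar_kind) : numFieldType :=
  match k with
  | RealScalars => R
  | ComplexScalars => R[i]
  end.

Definition of_real (R : realType) (k : scalar_kind) : R -> scalars R k :=
  match k with
  | RealScalars => fun x => x
  | ComplexScalars => fun x => x%:C
  end.

Section LocallyConvex.
Context (R : realType) (k : scalar_kind).
Local Notation K := (scalars R k).
Context (X : tvsType K).

Definition seminorm (q : X -> R) : Prop :=
  [/\ forall x, 0 <= q x,
      forall x y, q (x + y) <= q x + q y &
      forall (a : K) x, of_real k (q (a *: x)) = `|a| * of_real k (q x)].

Definition generating_seminorms (Omega : Type) (p : Omega -> X -> R) : Prop :=
  (forall a, seminorm (p a)) /\
  forall (x : X) (A : set X),
    nbhs x A <->
    exists n (a : 'I_n -> Omega) (e : R),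
      0 < e /\ [set y | forall i, p (a i) (y - x) < e] `<=` A.

(* The uniform structure carried by a tvsType is only required to induce the
   topology, not to be translation invariant. Completeness is therefore stated
   with the Cauchy filters of the additive group X. *)
Definition complete_tvs : Prop :=
  forall F : set_system X, ProperFilter F ->
    (fun z : X * X => z.1 - z.2) @ (F, F) --> (0 : X) ->
    exists x : X, F --> x.

Definition linear_subspace (V : lmodType K) (A : set V) : Prop :=
  A 0 /\ forall (a : K) x y, A x -> A y -> A (a *: x + y).

Definition dual : Type :=
  {phi : X -> K^o | linear phi /\ continuous phi}.

(* sigma(X, X^* ): the coarsest topology making every phi in X^* continuous *)
Definition weak_space : topologicalType :=
  sup_topology (fun phi : dual => Topological.class (initial_topology (sval phi))).

Definition weakly_cvg (u : nat -> X) (l : X) : Prop :=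
  (u : nat -> weak_space) @ \oo --> (l : weak_space).

Definition subsequences_have_convergent_subsequence (u : nat -> X) : Prop :=
  forall i : nat -> nat, {homo i : m n / (m < n)%N} ->
  exists2 j : nat -> nat, {homo j : m n / (m < n)%N} &
  exists l : X, u \o i \o j @ \oo --> l.

Definition subsequences_have_weakly_convergent_subsequence
    (u : nat -> X) : Prop :=
  forall i : nat -> nat, {homo i : m n / (m < n)%N} ->
  exists2 j : nat -> nat, {homo j : m n / (m < n)%N} &
  exists l : X, weakly_cvg (u \o i \o j) l.

(* A not necessarily everywhere defined operator is given by its graph. *)
Definition dom (G : set (X * X)) : set X := [set x | exists y, G (x, y)].

Definition app (G : set (X * X)) (x : X) : X := xget 0 [set y | G (x, y)].

Definition linear_operator_graph (G : set (X * X)) : Prop :=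
  linear_subspace (G : set (X * X)%type) /\
  forall x y z, G (x, y) -> G (x, z) -> y = z.

Definition op_add (C D : set (X * X)) : set (X * X) :=
  [set u | exists y z, [/\ C (u.1, y), D (u.1, z) & u.2 = y + z]].

Definition closable (G : set (X * X)) : Prop :=
  linear_operator_graph (closure G).

(* Families indexed by [0, +oo[ are functions on R; only their values at
   nonnegative arguments are ever constrained or used. *)
Section Semigroups.
Context (Omega : Type) (p : Omega -> X -> R).

Definition equicontinuous_family (Gs : set (X -> X)) : Prop :=
  forall a : Omega, exists n (c : 'I_n -> Omega) (b : 'I_n -> R),
    (forall i, 0 < b i) /\
    forall G, Gs G -> forall x, p a (G x) <= \sum_(i < n) b i * p (c i) x.

Definition bounded_powers (F : R -> X -> X) (s : R) : set (X -> X) :=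
  [set G | exists n m : nat, exists d : R,
    [/\ (0 < n)%N, (0 < m)%N, 0 <= d, m%:R * d / n%:R <= s &
        G = iter m (F (d / n%:R))]].

Definition class_E (F : R -> X -> X) : Prop :=
  [/\ forall s, 0 <= s -> linear (F s) /\ continuous (F s),
      F 0 = id &
      forall s, 0 <= s -> equicontinuous_family (bounded_powers F s)].

Definition lC0_semigroup (T : R -> X -> X) : Prop :=
  [/\ {within `[0, +oo[, continuous (fun s : R => (T s : {ptws X -> X}))},
      T 0 = id,
      forall l m, 0 <= l -> 0 <= m -> T (l + m) = T l \o T m &
      class_E T].

Definition generator (T : R -> X -> X) : set (X * X) :=
  [set u | of_real k h^-1 *: (T h u.1 - u.1) @[h --> 0^'+] --> u.2].

(* T is the semigroup exp (s Z) *)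
Definition generates (Z : set (X * X)) (T : R -> X -> X) : Prop :=
  lC0_semigroup T /\ generator T = Z.

End Semigroups.

(* Sequences indexed by n >= 1 are shifted: their n-th term sits at n.-1. *)
Definition approximation_conditions (F : R -> X -> X) (Z : set (X * X))
    (t : R) (A : set X) : Prop :=
  forall f : X, A f -> forall s : R, 0 <= s ->
  exists g : nat -> X,
    [/\ forall n, dom Z (g n),
        weakly_cvg (fun n =>
          iter (Num.truncn (n.+1%:R * s)) (F (t / n.+1%:R)) f - g n) 0,
        subsequences_have_convergent_subsequence (fun n =>
          iter (Num.truncn (n.+1%:R * s / t)) (F (t / n.+1%:R)) f) &
        subsequences_have_weakly_convergent_subsequence (fun n =>
          app Z (g n))].

End LocallyConvex.

(* Main.v *)
Require Import Defs.
From HB Require Import structures.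
From mathcomp Require Import all_boot all_order all_algebra.
From mathcomp Require Import all_classical all_reals.
From mathcomp Require Import topology normedtype.
From mathcomp.real_closed Require Import complex.
From mathcomp Require Import ring lra.

(* Write G = C + D, Z for its closure, and N = [s/h]. If v is continuous with
   values in D(Z) and has right derivative v' = Zv, then F(h)^N v(0) --> v(s) as
   h --> 0+: for z in D(Z) one has F(h)^m z = z + mh Zz + o(tau) when mh <= tau,
   which bounds the growth of the error of F(h)^N v(0) against v(s) from s to
   s + tau, and a supremum argument over s concludes. The same expansion at z = 0
   shows that G is closable.

   Given (a)-(c) and f in A, the maps s |-> F(t/n)^[ns/t] f are asymptotically
   equi-Lipschitz, so (b) and a diagonal extraction over rational times give a
   subsequence converging at every time to some v. By (a) and (c), (v(s), w) is a
   weak limit of points of the graph of Z for some w, so v(s) is in D(Z), a closed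
   subspace being weakly closed (Hahn-Banach); hence v solves v' = Zv, and
   T(s)f = v(s) is the limit of the whole family F(h)^N f. Density and
   equicontinuity extend T to X. Its generator contains Z by the expansion above,
   and is contained in Z because T(s)A is in D(Z): averages of T(s)f over [0, d]
   are limits of Riemann sums in D(Z).

   Conversely, if Z generates T, then v(s) = T(s)f solves v' = Zv for f in D(Z),
   so that F(t/n)^[ns] f --> T(ts)f and f_n^s = T(ts)f satisfies (a)-(c). *)

Set Implicit Arguments.
Unset Strict Implicit.
Unset Printing Implicit Defensive.

Import Order.TTheory GRing.Theory Num.Theory.
Import numFieldTopology.Exports numFieldNormedType.Exports.

Local Open Scope classical_set_scope.
Local Open Scope ring_scope.

(* The square-zero extension of R by V: it turns identities between linear
   combinations into commutative ring identities, within reach of [ring]. *)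
Definition sqzero (R : comNzRingType) (V : lmodType R) : Type := (R * V)%type.

Section SquareZero.
Context (R : comNzRingType) (V : lmodType R).
Local Notation S := (sqzero V).

HB.instance Definition _ := GRing.Zmodule.on S.

Let one : S := (1, 0).
Let mul (x y : S) : S := (x.1 * y.1, x.1 *: y.2 + y.1 *: x.2).

Let mulA : associative mul.
Proof.
move=> [a x] [b y] [c z]; congr pair => /=; first by rewrite mulrA.
by rewrite !scalerDr !scalerA addrA (mulrC c a) (mulrC c b).
Qed.
Let mulC : commutative mul.
Proof. by move=> [a x] [b y]; congr pair => /=; rewrite 1?mulrC 1?addrC. Qed.
Let mul1 : left_id one mul.
Proof. by move=> [a x]; congr pair; rewrite /= ?mul1r ?scale1r ?scaler0 ?addr0. Qed.
Let mulD : left_distributive mul +%R.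
Proof.
move=> [a x] [b y] [c z]; congr pair => /=; first by rewrite mulrDl.
by rewrite scalerDl scalerDr addrACA.
Qed.
Let one_neq0 : one != 0.
Proof. by apply/eqP => -[] /eqP; rewrite oner_eq0. Qed.

HB.instance Definition _ := GRing.Zmodule_isComNzRing.Build S
  mulA mulC mul1 mulD one_neq0.

Definition sqvec (x : V) : S := (0, x).
Definition sqscal (a : R) : S := (a, 0).

Lemma sqvec_inj : injective sqvec. Proof. by move=> x y []. Qed.
Lemma sqvecD x y : sqvec (x + y) = sqvec x + sqvec y.
Proof. by congr pair; rewrite /= addr0. Qed.
Lemma sqvecN x : sqvec (- x) = - sqvec x.
Proof. by congr pair; rewrite /= oppr0. Qed.
Lemma sqvec0 : sqvec 0 = 0. Proof. by []. Qed.
Lemma sqvecZ a x : sqvec (a *: x) = sqscal a * sqvec x.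
Proof. by congr pair; rewrite /= ?mulr0 ?scaler0 ?scale0r ?addr0. Qed.
Lemma sqscalD a b : sqscal (a + b) = sqscal a + sqscal b.
Proof. by congr pair; rewrite /= addr0. Qed.
Lemma sqscalN a : sqscal (- a) = - sqscal a.
Proof. by congr pair; rewrite /= oppr0. Qed.
Lemma sqscalM a b : sqscal (a * b) = sqscal a * sqscal b.
Proof. by congr pair; rewrite /= !scaler0 addr0. Qed.
Lemma sqscal0 : sqscal 0 = 0. Proof. by []. Qed.
Lemma sqscal1 : sqscal 1 = 1. Proof. by []. Qed.

End SquareZero.

Definition sqE := (sqvecD, sqvecN, sqvec0, sqvecZ,
  sqscalD, sqscalN, sqscalM, sqscal0, sqscal1).

Ltac lmod := apply: sqvec_inj; rewrite ?sqE; ring.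

(** * The Hahn-Banach theorem *)

Section HahnBanach.
Context (R : realType) (V : lmodType R).
Implicit Types (d : V -> R) (x y : V).

Definition sublinear d : Prop :=
  (forall x y, d (x + y) <= d x + d y) /\
  forall (r : R) x, 0 <= r -> d (r *: x) <= r * d x.

Lemma sublinear_opp d x : sublinear d -> - d (- x) <= d x.
Proof.
case=> dD dZ; rewrite lerNl -subr_ge0 opprK.
have d0 : 0 <= d 0 by have := dD 0 0; rewrite addr0 -subr_ge0 addrK.
by apply: le_trans d0 _; rewrite -(addNr x); apply: dD.
Qed.

(** No member of the family has to be sublinear: it is enough that sums and nonnegative multiples
    are dominated by some other member, while [b] keeps the infimum finite. This serves for lowering
    a functional, for chains in Zorn's lemma and for the distance to a subspace. *)
Lemma inf_sublinear (I : Type) (A : set I) (f : I -> V -> R) (b : V -> R) :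
  A !=set0 ->
  (forall i x, A i -> b x <= f i x) ->
  (forall i j x y, A i -> A j ->
     exists2 l, A l & f l (x + y) <= f i x + f j y) ->
  (forall i r x, A i -> 0 <= r -> exists2 l, A l & f l (r *: x) <= r * f i x) ->
  [/\ sublinear (fun x => inf [set f i x | i in A]),
      (forall i x, A i -> inf [set f i x | i in A] <= f i x) &
      (forall x, b x <= inf [set f i x | i in A])].
Proof.
move=> [i0 Ai0] fb fD fZ; set g := fun x => inf _.
have gle i x : A i -> g x <= f i x.
  move=> Ai; apply: ge_inf; last by exists i.
  by exists (b x) => _ [j Aj <-]; exact: fb.
have leg c x : (forall i, A i -> c <= f i x) -> c <= g x.
  move=> h; apply: lb_le_inf; first by exists (f i0 x), i0.
  by move=> _ [i Ai <-]; exact: h.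
split=> //; last by move=> x; apply: (leg) => i; exact: fb.
split=> [x y|r x r0].
  rewrite -lerBlDr; apply: (leg) => i Ai.
  rewrite lerBlDr [leRHS]addrC -lerBlDr; apply: (leg) => j Aj.
  have [l Al le] := fD _ _ x y Ai Aj.
  by rewrite lerBlDr [leRHS]addrC; apply: le_trans le; exact: gle.
have [->|rn0] := eqVneq r 0.
  by have [l /gle/le_trans le /le] := fZ i0 0 x Ai0 (lexx _); rewrite !mul0r.
rewrite mulrC -ler_pdivrMr ?lt_def ?rn0//; apply: (leg) => i Ai.
rewrite ler_pdivrMr ?lt_def ?rn0// mulrC.
have [l Al le] := fZ i r x Ai r0.
by apply: le_trans le; exact: gle.
Qed.

Lemma sublinearZ d r x : sublinear d -> 0 <= r -> d (r *: x) = r * d x.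
Proof.
move=> sd; have [dD dZ] := sd; rewrite le0r => /orP[/eqP->|r0].
  rewrite scale0r mul0r; apply/eqP; rewrite eq_le; apply/andP; split.
    by have := dZ 0 0 (lexx _); rewrite scale0r mul0r.
  by have := dD 0 0; rewrite addr0 -subr_ge0 addrK.
apply/eqP; rewrite eq_le; apply/andP; split; first exact/dZ/ltW.
rewrite -ler_pdivlMl//.
by rewrite -{1}(scalerK (lt0r_neq0 r0) x) dZ// invr_ge0 ltW.
Qed.

(* Subtracting the slope in direction y makes a sublinear functional odd
   at y. *)
Lemma sublinear_lower d y : sublinear d ->
  exists e, [/\ sublinear e, forall x, e x <= d x & e (- y) <= - d y].
Proof.
move=> sd; have [dD dZ] := sd.
have [||||se ge _] := @inf_sublinear R [set r | 0 <= r]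
  (fun r x => d (x + r *: y) - r * d y) (fun x => - d (- x)).
- by exists 0 => /=.
- move=> r x r0 /=; rewrite -sublinearZ// lerNl opprB lerBlDr.
  by have := dD (- x) (x + r *: y); rewrite addKr.
- move=> r s x z /= r0 s0; exists (r + s); first exact: addr_ge0.
  rewrite mulrDl addrACA -opprD lerD2r.
  by apply: le_trans (dD _ _); rewrite addrACA -scalerDl.
- move=> r s x /= r0 s0; exists (s * r); first exact: mulr_ge0.
  by rewrite mulrBr mulrA lerD2r -scalerA -scalerDr dZ.
(* The functional is the infimum over r >= 0 of d (x + r y) - r d y. Taking r = 0 gives e <= d, and
   r = 1 gives e (- y) <= d 0 - d y = - d y. *)
eexists; split; first exact: se.
  by move=> x; apply: le_trans (ge 0 _ _) _ => //=; rewrite scale0r mul0r addr0 subr0.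
apply: le_trans (ge 1 _ _) _ => //=.
have := sublinearZ 0 sd (lexx 0); rewrite scale0r mul0r => d0.
by rewrite scale1r addNr mul1r d0 sub0r.
Qed.

(** Zorn's lemma applies to the sublinear functionals below [d], since the pointwise infimum of a
    chain is sublinear, with x |-> - d (- x) as a lower bound. *)
Lemma minimal_sublinear d : sublinear d ->
  exists e, [/\ sublinear e, forall x, e x <= d x &
    forall e', sublinear e' -> (forall x, e' x <= e x) -> e' = e].
Proof.
move=> sd; pose T := {e : V -> R | sublinear e /\ forall x, e x <= d x}.
(* The order is reversed, so that a maximal element is a minimal functional. The empty chain is
   bounded by [d] itself. *)
pose le (s t : T) := `[< forall x, sval t x <= sval s x >].
have [||||[e [se ed]] emin] := @Zorn T le.
- by move=> s; apply/asboolP.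
- move=> r s t /asboolP rs /asboolP st; apply/asboolP => x.
  exact: le_trans (st x) (rs x).
- move=> [s ps] [t pt] /asboolP /= st /asboolP /= ts; apply: eq_exist.
  by apply/funext => x; apply/eqP; rewrite eq_le ts st.
- move=> A Atot; have [[t0 At0]|A0] := pselect (A !=set0); last first.
    exists (exist _ d (conj sd (fun=> lexx _))) => s As.
    by case: A0; exists s.
  have [||||si ile _] := @inf_sublinear T A (fun s => sval s)
    (fun x => - d (- x)).
  + by exists t0.
  + move=> [s [ss sd']] x _ /=; apply: le_trans (sublinear_opp _ ss).
    by rewrite lerN2.
  + move=> s t x y As At; have [/asboolP st|/asboolP ts] := Atot _ _ As At.
      exists t => //; apply: le_trans ((proj2_sig t).1.1 _ _) _.
      by rewrite lerD2r.
    exists s => //; apply: le_trans ((proj2_sig s).1.1 _ _) _.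
    by rewrite lerD2l.
  + by move=> s r x As r0; exists s => //; exact: (proj2_sig s).1.2.
  have id x : inf [set sval i x | i in A] <= d x.
    by apply: le_trans (ile t0 _ At0) ((proj2_sig t0).2 x).
  by exists (exist _ (fun x => inf _) (conj si id) : T) => s As; apply/asboolP => x; exact: ile.
exists e; split => // e' se' ee'.
have e'd x : e' x <= d x by exact: le_trans (ee' x) (ed x).
have /emin : le (exist _ e (conj se ed)) (exist _ e' (conj se' e'd)).
  exact/asboolP.
by case.
Qed.

(** A minimal sublinear functional is odd, because lowering it in a direction gives a functional
    below it, hence equal to it; odd and sublinear means linear. Lowering [d] at [x0] before
    minimizing forces the value at [x0]. *)
Lemma hahn_banach d x0 : sublinear d ->
  exists l : V -> R, [/\ forall r x y, l (r *: x + y) = r * l x + l y,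
    forall x, l x <= d x & l x0 = d x0].
Proof.
move=> sd; have [e [se ed ex0]] := sublinear_lower x0 sd.
have [l [sl le lmin]] := minimal_sublinear se.
have lN x : l (- x) = - l x.
  apply/eqP; rewrite eq_le; apply/andP; split.
    by have [l0 [sl0 l0l]] := sublinear_lower x sl; rewrite (lmin l0 sl0 l0l).
  by have := sublinear_opp x sl; rewrite lerNl.
have lD x y : l (x + y) = l x + l y.
  apply/eqP; rewrite eq_le sl.1/= -lerN2 opprD -!lN opprD; exact: sl.1.
have lZ r x : l (r *: x) = r * l x.
  have [r0|r0] := leP 0 r; first exact: sublinearZ.
  by rewrite -{1}[r]opprK scaleNr lN sublinearZ ?oppr_ge0 ?ltW// mulNr opprK.
exists l; split => [r x y|x|]; first by rewrite lD lZ.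
- exact: le_trans (le x) (ed x).
- apply/eqP; rewrite eq_le; apply/andP; split; first exact: le_trans (le _) _.
  by rewrite -lerN2 -lN; exact: le_trans (le _) _.
Qed.

End HahnBanach.

(** * Real-linear maps, seminorms and the telescoping estimate for iterates *)

Section LinearMaps.
Context (R : realType) (V : lmodType R).
Implicit Types (f : V -> V) (x y : V).

Definition rlinear f : Prop := forall (r : R) x y, f (r *: x + y) = r *: f x + f y.

Lemma rlinearD f x y : rlinear f -> f (x + y) = f x + f y.
Proof. by move=> fl; have := fl 1 x y; rewrite !scale1r. Qed.

Lemma rlinear0 f : rlinear f -> f 0 = 0.
Proof. by move=> fl; apply: (addrI (f 0)); rewrite -(rlinearD _ _ fl) !addr0. Qed.

Lemma rlinearZ f r x : rlinear f -> f (r *: x) = r *: f x.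
Proof. by move=> fl; have := fl r x 0; rewrite (rlinear0 fl) !addr0. Qed.

Lemma rlinearB f x y : rlinear f -> f (x - y) = f x - f y.
Proof.
by move=> fl; have := fl (- 1) y x; rewrite !scaleN1r [- y + _]addrC [- f y + _]addrC.
Qed.

Lemma rlinear_iter f m : rlinear f -> rlinear (iter m f).
Proof. by move=> fl r x y; elim: m => //= m ->; rewrite fl. Qed.

Definition rseminorm (q : V -> R) : Prop :=
  [/\ forall x, 0 <= q x, forall x y, q (x + y) <= q x + q y &
      forall r x, q (r *: x) = `|r| * q x].

Lemma rseminorm0 q : rseminorm q -> q 0 = 0.
Proof. by case=> _ _ qZ; rewrite -(scale0r 0) qZ normr0 mul0r. Qed.

Lemma rseminormN q x : rseminorm q -> q (- x) = q x.
Proof. by case=> _ _ qZ; rewrite -scaleN1r qZ normrN1 mul1r. Qed.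

Lemma rseminormBC q x y : rseminorm q -> q (x - y) = q (y - x).
Proof. by move=> sq; rewrite -(rseminormN _ sq) opprB. Qed.

Lemma rseminormB q x y : rseminorm q -> q (x - y) <= q x + q y.
Proof. by move=> sq; rewrite -[in leRHS](rseminormN y sq); case: sq. Qed.

Lemma rseminorm_tri q y x z : rseminorm q -> q (x - z) <= q (x - y) + q (y - z).
Proof. by case=> _ qD _; apply: le_trans (qD _ _); rewrite addrA subrK. Qed.

(** Telescoping: the left-hand vector is the sum over j < m of f^j (f x - x - h w) + h (f^j w - w).
    The seminorm [q'] absorbs the iterates f^j uniformly, so the bound grows only linearly in m. *)
Lemma iter_increment_bound (f : V -> V) (q q' : V -> R) (m : nat) (h a b : R)
    (x w : V) :
  rlinear f -> rseminorm q -> 0 <= h ->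
  (forall j y, (j < m)%N -> q (iter j f y) <= q' y) ->
  q' (f x - x - h *: w) <= a ->
  (forall j, (j < m)%N -> q (iter j f w - w) <= b) ->
  q (iter m f x - x - (m%:R * h) *: w) <= m%:R * (a + h * b).
Proof.
move=> fl sq h0 qq' xa wb; have [_ qD qZ] := sq.
elim: m qq' wb => [|m IHm] qq' wb.
  by rewrite /= subrr !mul0r scale0r subr0 rseminorm0.
have fml := @rlinear_iter f m fl.
have -> : iter m.+1 f x - x - (m.+1%:R * h) *: w =
    iter m f x - x - (m%:R * h) *: w +
    (iter m f (f x - x - h *: w) + h *: (iter m f w - w)).
  by rewrite !(rlinearB _ _ fml) (rlinearZ _ _ fml) -iterSr -natr1; lmod.
apply: le_trans (qD _ _) _; rewrite -natr1 [leRHS]mulrDl lerD ?IHm//.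
- by move=> j y jm; apply: qq'; exact: ltnW.
- by move=> j jm; apply: wb; exact: ltnW.
apply: le_trans (qD _ _) _; rewrite mul1r lerD//.
  by apply: le_trans xa; apply: qq'.
by rewrite qZ ger0_norm// ler_wpM2l// wb.
Qed.

End LinearMaps.

(** * The number of steps of length h that fit into a time s *)

Section Steps.
Context (R : realType).
Implicit Types s h : R.

Definition steps s h : nat := Num.truncn (s / h).

Lemma steps_le s h : 0 <= s -> 0 < h -> (steps s h)%:R * h <= s.
Proof.
move=> s0 h0; rewrite -ler_pdivlMr//.
by have /andP[] := truncn_itv (divr_ge0 s0 (ltW h0)).
Qed.

Lemma steps_gt s h : 0 <= s -> 0 < h -> s < (steps s h)%:R * h + h.
Proof.
move=> s0 h0; rewrite -[X in _ + X]mul1r -mulrDl natr1 -ltr_pdivrMr//.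
by have /andP[] := truncn_itv (divr_ge0 s0 (ltW h0)).
Qed.

Lemma steps_homo s s' h : 0 <= h -> s <= s' -> (steps s h <= steps s' h)%N.
Proof. by move=> h0 ss'; apply: le_truncn; rewrite ler_wpM2r// invr_ge0. Qed.

End Steps.

(** * Subsequences and diagonal extraction *)

Section Sequences.
Implicit Types i j d g : nat -> nat.

Definition increasing_seq i : Prop := {homo i : m n / (m < n)%N}.

Lemma increasing_seqP i : (forall n, (i n < i n.+1)%N) -> increasing_seq i.
Proof. exact: (homo_ltn ltn_trans). Qed.

Lemma increasing_seq_ge i n : increasing_seq i -> (n <= i n)%N.
Proof. by move=> ii; elim: n => // n /leq_ltn_trans; apply; exact: ii. Qed.

Lemma increasing_seq_comp i j :
  increasing_seq i -> increasing_seq j -> increasing_seq (i \o j).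
Proof. by move=> ii ij m n mn; apply/ii/ij. Qed.

Lemma increasing_seq_near i (A : nat -> Prop) : increasing_seq i ->
  (\forall n \near \oo, A n) -> \forall n \near \oo, A (i n).
Proof.
move=> ii [N _ NA]; exists N => // n /= Nn; apply: NA.
exact: leq_trans Nn (increasing_seq_ge n ii).
Qed.

Lemma increasing_seq_cvg i : increasing_seq i -> i @ \oo --> \oo.
Proof. by move=> ii A /(increasing_seq_near ii). Qed.

(** From index k + 1 on, the diagonal of the nested extractions is a subsequence of the one that
    satisfies Q k. The second hypothesis therefore lets Q k ignore [m] initial terms. *)
Lemma diagonal_subsequence (Q : nat -> (nat -> nat) -> Prop) :
  (forall k i, increasing_seq i -> exists2 j, increasing_seq j & Q k (i \o j)) ->
  (forall k m i g d, increasing_seq g -> Q k i ->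
     (forall n, d (n + m)%N = i (g n)) -> Q k d) ->
  exists2 d, increasing_seq d & forall k, Q k d.
Proof.
move=> Qex Qsub.
(* The extraction is made a total function of the index and the sequence; on sequences that do not
   increase its value is irrelevant. *)
have /choice[J HJ] (ki : nat * (nat -> nat)) : exists j, increasing_seq ki.2 ->
    increasing_seq j /\ Q ki.1 (ki.2 \o j).
  have [ii|nii] := pselect (increasing_seq ki.2); last by exists id.
  by have [j ij Qj] := Qex ki.1 _ ii; exists j.
pose I := fix I k := if k is k'.+1 then I k' \o J (k', I k') else id.
have II k : increasing_seq (I k).
  elim: k => [|k IHk] //=; apply: increasing_seq_comp => //.
  exact: (HJ (k, I k) IHk).1.
have JI k : increasing_seq (J (k, I k)) by exact: (HJ (k, I k) (II k)).1.
have QI k : Q k (I k.+1) by exact: (HJ (k, I k) (II k)).2.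
exists (fun n => I n n).
  by apply: increasing_seqP => n /=; apply: II; exact: increasing_seq_ge.
move=> k.
(* [H n] collects the extractions made after stage k + 1, so that the shifted diagonal is [I k.+1]
   along n |-> H n (n + k + 1). *)
pose H := fix H n := if n is n'.+1 then H n' \o J (n' + k.+1, I (n' + k.+1))%N
  else id.
have IH n : I (n + k.+1)%N = I k.+1 \o H n.
  by elim: n => //= n ->; rewrite compA.
have HH n : increasing_seq (H n).
  by elim: n => //= n IHn; exact: increasing_seq_comp.
apply: (Qsub k k.+1 (I k.+1) (fun n => H n (n + k.+1)%N)) => //.
  by apply: increasing_seqP => n /=; apply: HH; exact: increasing_seq_ge.
by move=> n; rewrite IH.
Qed.

Lemma steplength_near (R : realType) (t : R) i (A : R -> Prop) : 0 < t ->
  increasing_seq i -> (\forall h \near 0^'+, A h) ->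
  \forall n \near \oo, A (t / (i n).+1%:R).
Proof.
move=> t0 ii [e /= e0 eA]; apply: (increasing_seq_near (A := fun n => A (_ / n.+1%:R)) ii).
exists (Num.truncn (t / e)) => // n /= tn; apply: eA => /=; last first.
  by rewrite divr_gt0.
rewrite sub0r normrN gtr0_norm ?divr_gt0// ltr_pdivrMr// mulrC -ltr_pdivrMr//.
have /andP[_ /lt_le_trans] := truncn_itv (ltW (divr_gt0 t0 e0)).
by apply; rewrite ler_nat.
Qed.

End Sequences.

(** * Product formulas on a real vector space with seminorms *)

Section Consistency.
Context (R : realType) (V : lmodType R) (P : set (V -> R)) (F : R -> V -> V)
  (G : set (V * V)).
Hypothesis Psemi : forall q, P q -> rseminorm q.
Hypothesis Fl : forall h : R, 0 <= h -> rlinear (F h).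
(** Stability, to be combined with the consistency [Fder]. The case m = 0 is included, so [q'] also
    dominates [q]. *)
Hypothesis Feq : forall q (s : R), P q -> 0 <= s -> exists2 q', P q' &
  forall (h : R) m x, 0 <= h -> m%:R * h <= s -> q (iter m (F h) x) <= q' x.
Hypothesis Fder : forall u q (e : R), G u -> P q -> 0 < e ->
  \forall h \near 0^'+, q (F h u.1 - u.1 - h *: u.2) <= e * h.
Hypothesis Gdense : forall x q (e : R), P q -> 0 < e ->
  exists2 u, G u & q (u.1 - x) <= e.

(** The topological closure in the product, written with seminorms; [closure_dominated] identifies
    the two. One [q] for both components is enough there, as dominated seminorms can be added. *)
Definition graph_closure (A : set (V * V)) : set (V * V) :=
  [set u | forall q (e : R), P q -> 0 < e ->
    exists v, [/\ A v, q (v.1 - u.1) <= e & q (v.2 - u.2) <= e]].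

(** For the first component of a pair in [G], telescoping bounds the displacement by a multiple of m
    h; density and stability carry this over to every [y]. *)
Lemma iter_near_id y q (e : R) : P q -> 0 < e ->
  exists2 s : R, 0 < s & \forall h \near 0^'+,
    forall m, m%:R * h <= s -> q (iter m (F h) y - y) <= e.
Proof.
move=> Pq e0; have [q' Pq' qq'] := Feq Pq ler01.
have [u Gu ux] := Gdense y Pq' (divr_gt0 e0 (@ltr0n R 4)).
have [q'0 q'D q'Z] := Psemi Pq'; have sq := Psemi Pq; have [q0 qD _] := sq.
have c0 : 0 < q' u.2 + 1 by rewrite ltr_pwDr.
(* The bound 1 is the horizon on which [q'] was chosen; the other one makes the displacement of
   [u.1] at most e / 2. *)
exists (Num.min 1 (e / 2 / (q' u.2 + 1))).
  by rewrite lt_min ltr01 !divr_gt0.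
near=> h => m; rewrite le_min => /andP[mh1 mh].
have h0 : 0 < h by near: h; exact: nbhs_right_gt.
have Fh := Fl (ltW h0).
have jm j : (j <= m)%N -> forall x, q (iter j (F h) x) <= q' x.
  move=> jm x; apply: qq'; first exact: ltW.
  by apply: le_trans mh1; rewrite ler_pM2r// ler_nat.
have Fu : q' (F h u.1 - u.1) <= h * (q' u.2 + 1).
  rewrite -[X in q' X](subrK (h *: u.2)).
  apply: le_trans (q'D _ _) _; rewrite mulrDr addrC lerD//.
    by rewrite q'Z gtr0_norm.
  by rewrite mulrC; near: h; exact: Fder.
have inc : q (iter m (F h) u.1 - u.1) <= m%:R * h * (q' u.2 + 1).
  (* With w = 0 the second half of the telescoping sum vanishes. *)
  have := @iter_increment_bound _ _ (F h) q q' m h (h * (q' u.2 + 1)) 0 u.1 0 Fh sq (ltW h0).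
  rewrite !scaler0 !subr0 mulr0 addr0 -mulrA; apply => //.
    by move=> j z jm'; apply: jm; exact: ltnW.
  by move=> j _; rewrite subr0 (rlinear0 (rlinear_iter j Fh)) rseminorm0.
have -> : iter m (F h) y - y = iter m (F h) u.1 - u.1 -
    iter m (F h) (u.1 - y) + (u.1 - y).
  by rewrite (rlinearB _ _ (rlinear_iter m Fh)); lmod.
apply: le_trans (qD _ _) _; apply: le_trans (lerD (rseminormB _ _ sq) (lexx _)) _.
have := jm m (leqnn m) (u.1 - y); have := jm 0%N isT (u.1 - y) => /=.
have : m%:R * h * (q' u.2 + 1) <= e / 2 by rewrite -ler_pdivlMr.
move: inc ux; lra.
Unshelve. all: by end_near. Qed.

(** Telescoping with w = u.2 around a nearby pair of [G], where [iter_near_id] controls F(h)^j u.2 -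
    u.2. The range 2 s' leaves room for times m h that overshoot s' by a step. *)
Lemma graph_closure_derivative u q (e : R) : graph_closure G u -> P q -> 0 < e ->
  exists2 s : R, 0 < s & forall s', 0 < s' <= s ->
    \forall h \near 0^'+, forall m, m%:R * h <= 2 * s' ->
      q (iter m (F h) u.1 - u.1 - (m%:R * h) *: u.2) <= e * s'.
Proof.
move=> Gu Pq e0; have sq := Psemi Pq; have [q0 qD qZ] := sq.
have [q' Pq' qq'] := Feq Pq (@ler0n R 2); have [q'0 q'D q'Z] := Psemi Pq'.
have [t t0 tid] := iter_near_id u.2 Pq (divr_gt0 e0 (@ltr0n R 16)).
exists (Num.min 1 (t / 2)); first by rewrite lt_min ltr01 divr_gt0.
move=> s; rewrite le_min => /and3P[s0 s1 st].
(* The pair [v] is chosen after the time [s], so that replacing [u] by it costs only a fraction of e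
   s. *)
have [v [Gv v1 v2]] := Gu q' _ Pq' (divr_gt0 (mulr_gt0 e0 s0) (@ltr0n R 16)).
near=> h => m mh.
have h0 : 0 < h by near: h; exact: nbhs_right_gt.
have Fh := Fl (ltW h0).
have jm j : (j <= m)%N -> forall x, q (iter j (F h) x) <= q' x.
  move=> jm x; apply: qq'; first exact: ltW.
  apply: (@le_trans _ _ (m%:R * h)); first by rewrite ler_pM2r// ler_nat.
  by apply: le_trans mh _; rewrite ler_piMr.
have step : q' (F h v.1 - v.1 - h *: u.2) <= h * (e / 8).
  have -> : F h v.1 - v.1 - h *: u.2 =
    F h v.1 - v.1 - h *: v.2 + h *: (v.2 - u.2) by lmod.
  apply: le_trans (q'D _ _) _; rewrite q'Z gtr0_norm//.
  have : q' (F h v.1 - v.1 - h *: v.2) <= e / 16 * h.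
    by near: h; apply: Fder => //; exact: divr_gt0.
  have : h * q' (v.2 - u.2) <= h * (e / 16).
    rewrite ler_pM2l//; apply: le_trans v2 _.
    by rewrite ler_pM2r ?invr_gt0// ger_pMr.
  lra.
have := iter_increment_bound Fh sq (ltW h0) (fun j y jm' => jm j (ltnW jm') y)
  step.
move/(_ (e / 16)) => inc.
have {}inc : q (iter m (F h) v.1 - v.1 - (m%:R * h) *: u.2) <=
    m%:R * h * (e / 8 + e / 16).
  rewrite -mulrA mulrDr; apply: inc => j jm'.
  have : m%:R * h <= t by apply: le_trans mh _; rewrite -ler_pdivlMl// mulrC.
  move=> mt; have : forall m : nat, m%:R * h <= t ->
      q (iter m (F h) u.2 - u.2) <= e / 16 by near: h.
  apply; apply: le_trans mt; rewrite ler_pM2r// ler_nat; exact: ltnW.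
have -> : iter m (F h) u.1 - u.1 - (m%:R * h) *: u.2 =
    iter m (F h) v.1 - v.1 - (m%:R * h) *: u.2 -
    iter m (F h) (v.1 - u.1) + (v.1 - u.1).
  by rewrite (rlinearB _ _ (rlinear_iter m Fh)); lmod.
apply: le_trans (qD _ _) _; apply: le_trans (lerD (rseminormB _ _ sq) (lexx _)) _.
have := jm m (leqnn m) (v.1 - u.1); have := jm 0%N isT (v.1 - u.1) => /=.
have : m%:R * h * (e / 8 + e / 16) <= 2 * s * (e / 8 + e / 16).
  by rewrite ler_pM2r// addr_gt0// divr_gt0.
move: inc v1 (mulr_gt0 s0 e0); lra.
Unshelve. all: by end_near. Qed.

(** The iterates fix 0, so the expansion at (0, y) reads m h q(y) <= e s, with m chosen such that m
    h >= s. This is what makes the sum closable. *)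
Lemma graph_closure_functional y q :
  graph_closure G (0, y) -> P q -> q y = 0.
Proof.
move=> Gy Pq; have sq := Psemi Pq; have [q0 _ qZ] := sq.
apply/eqP; rewrite eq_le q0 andbT; apply/ler_addgt0Pr => e e0; rewrite add0r.
have [s s0 /(_ s)] := graph_closure_derivative Gy Pq e0.
rewrite s0 lexx => /(_ isT) der; near (0 : R)^'+ => h.
have h0 : 0 < h by near: h; exact: nbhs_right_gt.
have hs : h < s by near: h; exact: nbhs_right_lt.
have s2 : 0 <= 2 * s by rewrite mulr_ge0// ltW.
have /(_ (steps (2 * s) h) (steps_le s2 h0)) : forall m, m%:R * h <= 2 * s ->
  q (iter m (F h) 0 - 0 - (m%:R * h) *: y) <= e * s by near: h.
rewrite (rlinear0 (rlinear_iter _ (Fl (ltW h0)))) subr0 sub0r rseminormN// qZ.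
have := steps_gt s2 h0; set a := (_%:R * h) => sa.
have as_ : s <= a by lra.
rewrite ger0_norm; last by apply: le_trans as_; exact: ltW.
rewrite mulrC -ler_pdivlMr; last exact: lt_le_trans as_.
move=> /le_trans; apply.
rewrite ler_pdivrMr; last exact: lt_le_trans as_.
by rewrite ler_pM2l.
Unshelve. all: by end_near. Qed.

(** The equation v' = Zv with right derivatives, where Z has graph [graph_closure G]. Continuity
    from the left is not part of it and is stated by [left_continuous]. *)
Definition mild_solution (v : R -> V) : Prop := forall s : R, 0 <= s ->
  exists2 w, graph_closure G (v s, w) & forall q (e : R), P q -> 0 < e ->
  exists2 t : R, 0 < t & forall s', 0 < s' <= t ->
    q (v (s + s') - v s - s' *: w) <= e * s'.

Definition left_continuous (v : R -> V) : Prop :=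
  forall q (s e : R), P q -> 0 < e -> exists2 t : R, 0 < t &
  forall s', 0 <= s' <= s -> s - s' <= t -> q (v s' - v s) <= e.

(** * Convergence of the iterates to a given solution curve *)

Section Chernoff.
Variables (v : R -> V) (S : R) (q : V -> R).
Hypotheses (S0 : 0 <= S) (Pq : P q).

(** The error is measured after any j further iterations that stay within the horizon S. With this
    built in, errors add up when s is increased, instead of being multiplied by a stability constant
    each time. *)
Let tracks (e s : R) : Prop := forall c : R, 0 < c -> \forall h \near 0^'+,
  forall j, (j + steps s h)%:R * h <= S ->
  q (iter j (F h) (iter (steps s h) (F h) (v 0) - v s)) <= e * s + c.

(** Closedness from the left: between s' and s the curve moves little by left continuity, and the
    iterations in between move [v s] little by [iter_near_id]. *)
Let tracks_left (e s : R) : left_continuous v -> 0 < e -> 0 <= s <= S ->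
  (forall d : R, 0 < d -> exists s', [/\ 0 <= s' <= s, s - s' < d & tracks e s']) ->
  tracks e s.
Proof.
move=> vl e0 /andP[s0 sS] ex c c0; have [q' Pq' qq'] := Feq Pq S0.
have [q0 qD _] := Psemi Pq.
have c4 : 0 < c / 4 by rewrite divr_gt0.
have [t1 t10 id1] := iter_near_id (v s) Pq' c4.
have [t2 t20 id2] := vl _ s _ Pq' c4.
have [|s' [/andP[s'0 s's] s't tr]] := ex (Num.min (t1 / 2) t2).
  by rewrite lt_min t20 divr_gt0.
move: s't; rewrite lt_min => /andP[st1 st2].
have {}id2 : q' (v s' - v s) <= c / 4 by apply: id2; rewrite ?s'0// ltW.
near=> h => j jS.
have h0 : 0 < h by near: h; exact: nbhs_right_gt.
have ht : h < t1 / 2 by near: h; apply: nbhs_right_lt; rewrite divr_gt0.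
have Fh := Fl (ltW h0).
have ns := steps_homo (ltW h0) s's.
set n := (steps s h - steps s' h)%N.
have nE : steps s h = (n + steps s' h)%N by rewrite subnK.
have nt : n%:R * h <= t1.
  have := steps_le s0 h0; have := steps_gt s'0 h0.
  by rewrite nE natrD mulrDl; lra.
have jn i y : (i <= j + n)%N -> q (iter i (F h) y) <= q' y.
  move=> ijn; apply: qq'; first exact: ltW.
  apply: le_trans jS; rewrite ler_pM2r// ler_nat nE addnA.
  exact: leq_trans ijn (leq_addr _ _).
have -> : iter j (F h) (iter (steps s h) (F h) (v 0) - v s) =
    iter (j + n) (F h) (iter (steps s' h) (F h) (v 0) - v s') +
    (iter (j + n) (F h) (v s' - v s) + iter j (F h) (iter n (F h) (v s) - v s)).
  rewrite nE !iterD !(rlinearB _ _ (rlinear_iter _ Fh)); lmod.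
apply: le_trans (qD _ _) _; rewrite (_ : _ + c = e * s + c / 2 + (c / 4 + c / 4)); last by lra.
apply: lerD.
  apply: (@le_trans _ _ (e * s' + c / 2)); last by rewrite lerD2r ler_pM2l.
  move: jS; rewrite nE addnA; move: (j + n)%N; near: h; apply: tr.
  exact: divr_gt0.
apply: le_trans (qD _ _) _; apply: lerD.
  exact: le_trans (jn _ _ (leqnn _)) id2.
apply: le_trans (jn _ _ (leq_addr _ _)) _.
by move: nt; move: (n); near: h.
Unshelve. all: by end_near. Qed.

(** Openness to the right: starting from [v s], the iterates and the curve have the same first-order
    expansion, so over a short time d the error grows by at most e d. *)
Let tracks_right (e s : R) : mild_solution v -> 0 < e -> 0 <= s < S ->
  tracks e s -> exists s', s < s' <= S /\ tracks e s'.
Proof.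
move=> vs e0 /andP[s0 sS] tr; have [q' Pq' qq'] := Feq Pq S0.
have [q0 qD _] := Psemi Pq; have [q'0 q'D q'Z] := Psemi Pq'.
have e4 : 0 < e / 4 by rewrite divr_gt0.
have [w vw vd] := vs s s0.
have [t1 t10 der] := graph_closure_derivative vw Pq' e4.
have [t2 t20 vd'] := vd _ _ Pq' e4.
pose d := Num.min (Num.min t1 t2) (S - s).
have d0 : 0 < d by rewrite !lt_min t10 t20 subr_gt0.
have /and3P[d1 d2 dS] : [&& d <= t1, d <= t2 & d <= S - s].
  by rewrite !ge_min !lexx !orbT.
exists (s + d); split; first by rewrite ltrDl d0 -lerBrDl.
move=> c c0; have {}der := der d; have {}vd' := vd' d.
rewrite d0 d1 in der; rewrite d0 d2 in vd'.
have {}vd' := vd' isT; have {}der := der isT.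
have ed : 0 < e * d / 2 by rewrite divr_gt0// mulr_gt0.
have w0 : 0 < q' w + 1 by rewrite ltr_pwDr.
near=> h => j jS.
have h0 : 0 < h by near: h; exact: nbhs_right_gt.
have hd : h < d by near: h; exact: nbhs_right_lt.
have hw : h < e * d / 2 / (q' w + 1).
  by near: h; apply: nbhs_right_lt; rewrite divr_gt0.
have Fh := Fl (ltW h0).
have sd : s <= s + d by rewrite lerDl ltW.
have ns := steps_homo (ltW h0) sd.
set n := (steps (s + d) h - steps s h)%N.
have nE : steps (s + d) h = (n + steps s h)%N by rewrite subnK.
have sd0 := le_trans s0 sd.
have n1 : n%:R * h <= d + h.
  by have := steps_le sd0 h0; have := steps_gt s0 h0; rewrite nE natrD mulrDl; lra.
have n2 : d <= n%:R * h + h.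
  by have := steps_gt sd0 h0; have := steps_le s0 h0; rewrite nE natrD mulrDl; lra.
have jn i y : (i <= j + n)%N -> q (iter i (F h) y) <= q' y.
  move=> ijn; apply: qq'; first exact: ltW.
  apply: le_trans jS; rewrite ler_pM2r// ler_nat nE addnA.
  exact: leq_trans ijn (leq_addr _ _).
(* The inherited error, now followed by j + n iterations, plus three local errors: the expansion of
   the iterates, that of [v], and the rounding of d to n h. Their shares of e d are 1/4, 1/4 and
   1/2. *)
have -> : iter j (F h) (iter (steps (s + d) h) (F h) (v 0) - v (s + d)) =
    iter (j + n) (F h) (iter (steps s h) (F h) (v 0) - v s) +
    iter j (F h) ((iter n (F h) (v s) - v s - (n%:R * h) *: w) +
      (- (v (s + d) - v s - d *: w) + (n%:R * h - d) *: w)).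
  rewrite nE !iterD -(rlinearD _ _ (rlinear_iter j Fh)); congr iter.
  by rewrite (rlinearB _ _ (rlinear_iter n Fh)); lmod.
apply: le_trans (qD _ _) _.
rewrite (_ : _ + c = e * s + c + (e / 4 * d + (e / 4 * d + e * d / 2))); last by lra.
apply: lerD.
  move: jS; rewrite nE addnA; move: (j + n)%N; near: h; exact: tr.
apply: le_trans (jn _ _ (leq_addr _ _)) _.
apply: le_trans (q'D _ _) _; apply: lerD.
  have : n%:R * h <= 2 * d by lra.
  by move: (n); near: h.
apply: le_trans (q'D _ _) _; apply: lerD; first by rewrite rseminormN//; exact: Psemi.
rewrite q'Z; apply: (@le_trans _ _ (h * (q' w + 1))).
  apply: ler_pM => //; last by rewrite lerDl.
  by rewrite ler_norml; lra.
by rewrite -ler_pdivlMr// ltW.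
Unshelve. all: by end_near. Qed.

(** The times that are tracked contain 0; their supremum is tracked by [tracks_left], and by
    [tracks_right] it cannot be smaller than S. *)
Lemma chernoff (e : R) : mild_solution v -> left_continuous v -> 0 < e ->
  \forall h \near 0^'+, q (iter (steps S h) (F h) (v 0) - v S) <= e.
Proof.
move=> vs vl e0; have sq := Psemi Pq.
have S1 : 0 < S + 1 by rewrite ltr_pwDr.
(* This gives e' S <= e / 2; the summand 1 covers S = 0. *)
pose e' := e / 2 / (S + 1).
have e'0 : 0 < e' by rewrite !divr_gt0.
pose E := [set s | 0 <= s <= S /\ tracks e' s].
have E0 : E 0.
  split; first by rewrite lexx.
  move=> c c0; near=> h => j _.
  have h0 : 0 < h by near: h; exact: nbhs_right_gt.
  rewrite /steps mul0r truncn0 /= subrr (rlinear0 (rlinear_iter j (Fl (ltW h0)))).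
  by rewrite rseminorm0// mulr0 add0r ltW.
have supE : has_sup E by split; [exists 0|exists S => s [/andP[]]].
have sE : 0 <= sup E <= S.
  apply/andP; split; first exact: ub_le_sup supE.2 _ E0.
  by apply: ge_sup; [exists 0|move=> s [/andP[]]].
have trE : tracks e' (sup E).
  apply: tracks_left => // d d0; have [s Es sd] := sup_adherent d0 supE.
  exists s; split; last exact: Es.2.
    by rewrite (ub_le_sup supE.2 Es) andbT; case: Es.1 => /andP[].
  by rewrite ltrBlDr addrC -ltrBlDr.
have [SE|SE] := leP S (sup E).
  have supES : sup E = S by apply/eqP; rewrite eq_le SE andbT; case/andP: sE.
  rewrite supES in trE.
  near=> h.
  have h0 : 0 < h by near: h; exact: nbhs_right_gt.
  apply: (@le_trans _ _ (e' * S + e / 2)).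
    have /(_ 0%N) : forall j, (j + steps S h)%:R * h <= S ->
        q (iter j (F h) (iter (steps S h) (F h) (v 0) - v S)) <= e' * S + e / 2.
      by near: h; apply: trE; rewrite divr_gt0.
    by apply; rewrite add0n steps_le.
  have : e' * S <= e' * (S + 1) by rewrite ler_pM2l// lerDl.
  by rewrite divfK ?gt_eqF//; lra.
have [|s [/andP[s1 s2] trs]] := @tracks_right e' (sup E) vs e'0 _ trE.
  by rewrite SE andbT; case/andP: sE.
have := ub_le_sup supE.2 (_ : E s).
rewrite leNgt s1 => /(_ _)/notF -[]; split=> //; rewrite s2 andbT.
by apply: ltW; apply: le_lt_trans s1; case/andP: sE.
Unshelve. all: by end_near. Qed.

End Chernoff.

(** The limit runs over all h --> 0+ and not only over h = s / n, so that one step length can serve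
    several times s at once, as the semigroup law requires. *)
Definition product_limit (s : R) (x l : V) : Prop := forall q (e : R),
  P q -> 0 < e -> \forall h \near 0^'+, q (iter (steps s h) (F h) x - l) <= e.

Hypothesis Psep : forall x, (forall q, P q -> q x = 0) -> x = 0.
Hypothesis Pcomplete : forall Fi : set_system V, ProperFilter Fi ->
  (forall q (e : R), P q -> 0 < e ->
     exists2 B, Fi B & forall a b, B a -> B b -> q (a - b) <= e) ->
  exists x, forall q (e : R), P q -> 0 < e -> Fi [set a | q (a - x) <= e].

Lemma product_limit_le s x l q (y : V) (c : R) : P q -> product_limit s x l ->
  (\forall h \near 0^'+, q (iter (steps s h) (F h) x - y) <= c) -> q (l - y) <= c.
Proof.
move=> Pq xl xc; apply/ler_addgt0Pr => e e0; near (0 : R)^'+ => h.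
have sq := Psemi Pq.
apply: le_trans (rseminorm_tri (iter (steps s h) (F h) x) _ _ sq) _.
rewrite addrC lerD//; first by near: h.
by rewrite rseminormBC//; near: h; exact: xl.
Unshelve. all: by end_near. Qed.

Lemma product_limit_unique s x l l' :
  product_limit s x l -> product_limit s x l' -> l = l'.
Proof.
move=> xl xl'; apply/eqP; rewrite -subr_eq0; apply/eqP/Psep => q Pq.
apply/eqP; rewrite eq_le; have [-> _ _] := Psemi Pq; rewrite andbT.
apply/ler_addgt0Pr => e e0; rewrite add0r.
by apply: (product_limit_le Pq xl); exact: xl'.
Qed.

(** Stability turns convergence on a dense set into the Cauchy property everywhere, and completeness
    supplies the limit. *)
Lemma product_limit_total :
  (forall x q (e : R), P q -> 0 < e -> exists2 y, q (y - x) <= e &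
     forall s : R, 0 <= s -> exists l, product_limit s y l) ->
  forall (s : R) x, 0 <= s -> exists l, product_limit s x l.
Proof.
move=> dns s x s0.
have [|l xl] := @Pcomplete (iter (steps s h) (F h) x @[h --> (0 : R)^'+]) _.
  move=> q e Pq e0; have sq := Psemi Pq; have [q' Pq' qq'] := Feq Pq s0.
  have e4 : 0 < e / 4 by rewrite divr_gt0.
  have [y yx /(_ _ s0)[l yl]] := dns x _ _ Pq' e4.
  exists [set z | q (z - l) <= e / 2]; last first.
    move=> a b /= al bl; apply: le_trans (rseminorm_tri l _ _ sq) _.
    by rewrite (rseminormBC l)//; lra.
  rewrite nbhs_simpl /=; near=> h.
  have h0 : 0 < h by near: h; exact: nbhs_right_gt.
  apply: le_trans (rseminorm_tri (iter (steps s h) (F h) y) _ _ sq) _.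
  have : q (iter (steps s h) (F h) y - l) <= e / 4 by near: h; exact: yl.
  rewrite [q (iter _ _ x - _)]rseminormBC// -(rlinearB _ _ (rlinear_iter _ (Fl (ltW h0)))).
  have := qq' _ _ (y - x) (ltW h0) (steps_le s0 h0); move: yx; lra.
by exists l => q e Pq e0; exact: xl.
Unshelve. all: by end_near. Qed.

(** * The limit semigroup and its generator *)

Section LimitSemigroup.
Variable T : R -> V -> V.
Hypothesis HT : forall (s : R) x, 0 <= s -> product_limit s x (T s x).

Lemma limit_bound q q' (S s : R) x : P q ->
  (forall h m x, 0 <= h -> m%:R * h <= S -> q (iter m (F h) x) <= q' x) ->
  0 <= s <= S -> q (T s x) <= q' x.
Proof.
move=> Pq qq' /andP[s0 sS]; rewrite -[T s x]subr0.
apply: (product_limit_le Pq (HT x s0)); near=> h.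
have h0 : 0 < h by near: h; exact: nbhs_right_gt.
rewrite subr0; apply: qq'; first exact: ltW.
exact: le_trans (steps_le s0 h0) sS.
Unshelve. all: by end_near. Qed.

Lemma limit0 x : T 0 x = x.
Proof.
apply: product_limit_unique (HT x (lexx _)) _ => q e Pq e0; near=> h.
by rewrite /steps mul0r truncn0 /= subrr (rseminorm0 (Psemi Pq)) ltW.
Unshelve. all: by end_near. Qed.

Lemma limitD s x y : 0 <= s -> T s (x + y) = T s x + T s y.
Proof.
move=> s0; apply: product_limit_unique (HT _ s0) _ => q e Pq e0.
have [_ qD _] := Psemi Pq; have e2 : 0 < e / 2 by rewrite divr_gt0.
near=> h; have h0 : 0 < h by near: h; exact: nbhs_right_gt.
rewrite (rlinearD _ _ (rlinear_iter _ (Fl (ltW h0)))) opprD addrACA.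
apply: le_trans (qD _ _) _; rewrite [leRHS]splitr lerD//.
  by near: h; exact: (HT _ s0).
by near: h; exact: (HT _ s0).
Unshelve. all: by end_near. Qed.

(** Meant for multiplication by a possibly complex scalar, which the real structure of [V] does not
    see. *)
Lemma limit_comm (A : V -> V) s x :
  (forall x y, A (x - y) = A x - A y) ->
  (forall q, P q -> exists2 q', P q' & forall x, q (A x) <= q' x) ->
  (forall h x, 0 <= h -> F h (A x) = A (F h x)) ->
  0 <= s -> T s (A x) = A (T s x).
Proof.
move=> AB Aq AF s0; apply: product_limit_unique (HT _ s0) _ => q e Pq e0.
have [q' Pq' qA] := Aq q Pq; near=> h.
have h0 : 0 < h by near: h; exact: nbhs_right_gt.
have -> m : iter m (F h) (A x) = A (iter m (F h) x).
  by elim: m => //= m ->; rewrite AF// ltW.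
by rewrite -AB; apply: le_trans (qA _) _; near: h; exact: (HT _ s0).
Unshelve. all: by end_near. Qed.

Lemma limitZ s r x : 0 <= s -> T s (r *: x) = r *: T s x.
Proof.
move=> s0; apply: product_limit_unique (HT _ s0) _ => q e Pq e0.
have r1 : 0 < `|r| + 1 by rewrite ltr_pwDr.
have [q0 _ qZ] := Psemi Pq; near=> h.
have h0 : 0 < h by near: h; exact: nbhs_right_gt.
rewrite (rlinearZ _ _ (rlinear_iter _ (Fl (ltW h0)))) -scalerBr qZ.
apply: (@le_trans _ _ ((`|r| + 1) * (e / (`|r| + 1)))).
  apply: ler_pM => //; first by rewrite lerDl.
  by near: h; apply: (HT _ s0) => //; exact: divr_gt0.
by rewrite mulrC divfK// gt_eqF.
Unshelve. all: by end_near. Qed.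

Lemma limit_linear s : 0 <= s -> rlinear (T s).
Proof. by move=> s0 r x y; rewrite limitD// limitZ. Qed.

(** The steps for s and for s' together miss those for s + s' by a time less than 2 h, which
    [iter_near_id] absorbs. *)
Lemma limit_semigroup s s' x : 0 <= s -> 0 <= s' -> T (s + s') x = T s (T s' x).
Proof.
move=> s0 s'0; have ss'0 := addr_ge0 s0 s'0.
apply: product_limit_unique (HT _ ss'0) _ => q e Pq e0.
have [_ qD _] := Psemi Pq.
have [q' Pq' qq'] := Feq Pq ss'0; have e4 : 0 < e / 4 by rewrite divr_gt0.
have [t t0 tid] := iter_near_id (T s (T s' x)) Pq e4.
near=> h.
have h0 : 0 < h by near: h; exact: nbhs_right_gt.
have ht : h < t / 2 by near: h; apply: nbhs_right_lt; rewrite divr_gt0.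
have Fh := Fl (ltW h0).
have nn : (steps s h + steps s' h <= steps (s + s') h)%N.
  rewrite [leqRHS]/steps truncn_ge_nat; last by rewrite divr_ge0// ltW.
  by rewrite ler_pdivlMr// natrD mulrDl lerD// steps_le.
set n := (steps (s + s') h - (steps s h + steps s' h))%N.
have nE : steps (s + s') h = (n + (steps s h + steps s' h))%N by rewrite subnK.
have nt : n%:R * h <= t.
  have := steps_le ss'0 h0; have := steps_gt s0 h0; have := steps_gt s'0 h0.
  by rewrite nE !natrD !mulrDl; lra.
have qi i y : (i <= n + steps s h)%N -> q (iter i (F h) y) <= q' y.
  move=> ijn; apply: qq'; first exact: ltW.
  apply: le_trans (steps_le ss'0 h0); rewrite ler_pM2r// ler_nat nE addnA.
  exact: leq_trans ijn (leq_addr _ _).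
have -> : iter (steps (s + s') h) (F h) x - T s (T s' x) =
   iter (n + steps s h) (F h) (iter (steps s' h) (F h) x - T s' x) +
   (iter n (F h) (iter (steps s h) (F h) (T s' x) - T s (T s' x)) +
   (iter n (F h) (T s (T s' x)) - T s (T s' x))).
  by rewrite nE addnA !iterD !(rlinearB _ _ (rlinear_iter _ Fh)); lmod.
have b1 : q' (iter (steps s' h) (F h) x - T s' x) <= e / 4 by near: h; exact: (HT _ s'0).
have b2 : q' (iter (steps s h) (F h) (T s' x) - T s (T s' x)) <= e / 4.
  by near: h; exact: (HT _ s0).
have b3 : q (iter n (F h) (T s (T s' x)) - T s (T s' x)) <= e / 4.
  by move: (n) nt; near: h.
have := qi _ (iter (steps s' h) (F h) x - T s' x) (leqnn _).
have := qi _ (iter (steps s h) (F h) (T s' x) - T s (T s' x)) (leq_addr _ _).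
move=> c2 c1; apply: le_trans (qD _ _) _.
rewrite [leRHS](_ : e = e / 4 + (e / 4 + e / 2)); last by lra.
rewrite lerD//; first exact: le_trans c1 b1.
apply: le_trans (qD _ _) _; rewrite lerD//; first exact: le_trans c2 b2.
by apply: le_trans b3 _; lra.
Unshelve. all: by end_near. Qed.

Lemma limit_near_id y q (e : R) : P q -> 0 < e ->
  exists2 t : R, 0 < t & forall s, 0 <= s <= t -> q (T s y - y) <= e.
Proof.
move=> Pq e0; have [t t0 tid] := iter_near_id y Pq e0.
exists t => // s /andP[s0 st]; apply: (product_limit_le Pq (HT y s0)).
near=> h.
have h0 : 0 < h by near: h; exact: nbhs_right_gt.
have : (steps s h)%:R * h <= t by apply: le_trans (steps_le s0 h0) st.
by move: (steps s h); near: h.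
Unshelve. all: by end_near. Qed.

Lemma limit_derivative u q (e : R) : graph_closure G u -> P q -> 0 < e ->
  exists2 t : R, 0 < t & forall s, 0 < s <= t ->
    q (T s u.1 - u.1 - s *: u.2) <= e * s.
Proof.
move=> Gu Pq e0; have e2 : 0 < e / 2 by rewrite divr_gt0.
have sq := Psemi Pq; have [q0 qD qZ] := sq.
have [t t0 tder] := graph_closure_derivative Gu Pq e2.
exists t => // s st; have /andP[s0 _] := st.
have w0 : 0 < q u.2 + 1 by rewrite ltr_pwDr.
rewrite -addrA -opprD; apply: (product_limit_le Pq (HT u.1 (ltW s0))).
near=> h.
have h0 : 0 < h by near: h; exact: nbhs_right_gt.
have hw : h < e / 2 * s / (q u.2 + 1).
  by near: h; apply: nbhs_right_lt; rewrite divr_gt0// mulr_gt0.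
set n := steps s h.
have -> : iter n (F h) u.1 - (u.1 + s *: u.2) =
    iter n (F h) u.1 - u.1 - (n%:R * h) *: u.2 + (n%:R * h - s) *: u.2.
  by lmod.
apply: le_trans (qD _ _) _; rewrite [e]splitr mulrDl lerD//.
  have ns : n%:R * h <= 2 * s.
    by apply: le_trans (steps_le (ltW s0) h0) _; rewrite ler_peMl ?ltW// ltrDl.
  by move: (n) ns; near: h; exact: tder.
rewrite qZ; apply: (@le_trans _ _ (h * (q u.2 + 1))).
  apply: ler_pM => //; last by rewrite lerDl.
  have := steps_le (ltW s0) h0; have := steps_gt (ltW s0) h0.
  by rewrite ler_norml -/n; lra.
by rewrite -ler_pdivlMr// ltW.
Unshelve. all: by end_near. Qed.

Lemma graph_closure_idem u : (forall q (e : R), P q -> 0 < e ->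
    exists v, [/\ graph_closure G v, q (v.1 - u.1) <= e & q (v.2 - u.2) <= e]) ->
  graph_closure G u.
Proof.
move=> cl q e Pq e0; have e2 : 0 < e / 2 by rewrite divr_gt0.
have [v [Gv v1 v2]] := cl q _ Pq e2; have [w [Gw w1 w2]] := Gv q _ Pq e2.
have sq := Psemi Pq; exists w; split=> //.
  by apply: le_trans (rseminorm_tri v.1 _ _ sq) _; lra.
by apply: le_trans (rseminorm_tri v.2 _ _ sq) _; lra.
Qed.

(** Both T(s) (T(h) f - f) and T(h) T(s) f - T(s) f are the same vector, with first-order terms h
    T(s) w and h w'; dividing by h compares them. *)
Lemma limit_graph_closure f w s w' : 0 <= s ->
  graph_closure G (f, w) -> graph_closure G (T s f, w') -> w' = T s w.
Proof.
move=> s0 Gf Gs; apply/eqP; rewrite -subr_eq0; apply/eqP/Psep => q Pq.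
have sq := Psemi Pq; have [q0 qD qZ] := sq.
apply/eqP; rewrite eq_le q0 andbT.
apply/ler_addgt0Pr => e e0; rewrite add0r.
have e2 : 0 < e / 2 by rewrite divr_gt0.
have [q' Pq' qq'] := Feq Pq s0.
have [t1 t10 d1] := limit_derivative Gf Pq' e2.
have [t2 t20 d2] := limit_derivative Gs Pq e2.
pose h := Num.min t1 t2; have h0 : 0 < h by rewrite lt_min t10.
have /andP[h1 h2] : (h <= t1) && (h <= t2) by rewrite !ge_min !lexx orbT.
have {}d1 : q' (T h f - f - h *: w) <= e / 2 * h by apply: d1; rewrite h0.
have {}d2 : q (T h (T s f) - T s f - h *: w') <= e / 2 * h by apply: d2; rewrite h0.
have ss : 0 <= s <= s by rewrite s0 lexx.
have Ts := limit_linear s0.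
rewrite -(ler_pM2l h0) -[X in X * q _]gtr0_norm// -qZ.
have -> : h *: (w' - T s w) =
    T s (T h f - f - h *: w) - (T h (T s f) - T s f - h *: w').
  rewrite !(rlinearB _ _ Ts) (rlinearZ _ _ Ts).
  rewrite -(limit_semigroup f s0 (ltW h0)) -(limit_semigroup f (ltW h0) s0).
  by rewrite [s + h]addrC; lmod.
apply: le_trans (rseminormB _ _ sq) _.
rewrite mulrC [e]splitr mulrDl lerD//.
exact: le_trans (limit_bound _ Pq qq' ss) d1.
Qed.

(** For u = (x, y), the average of T(s) f over [0, d] is close to x, and Z should send it to (T(d) f
    - f) / d, which is close to y. Riemann sums, which lie in the domain because the T(s) f do,
    replace the integral. *)
Lemma limit_generator_sub (A : set V) u :
  graph_closure G 0 ->
  (forall (r : R) u v, graph_closure G u -> graph_closure G v ->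
     graph_closure G (r *: u + v)) ->
  (forall x q (e : R), P q -> 0 < e -> exists2 f, A f & q (f - x) <= e) ->
  (forall f (s : R), A f -> 0 <= s -> exists w, graph_closure G (T s f, w)) ->
  (forall q (e : R), P q -> 0 < e ->
     \forall h \near 0^'+, q (T h u.1 - u.1 - h *: u.2) <= e * h) ->
  graph_closure G u.
Proof.
case: u => x y /= G0 GL Ad AG der; apply: graph_closure_idem => q e Pq e0 /=.
have sq := Psemi Pq; have [q0 qD qZ] := sq.
have e8 : 0 < e / 8 by rewrite divr_gt0.
have [q' Pq' qq'] := Feq Pq ler01; have [q'0 q'D q'Z] := Psemi Pq'.
have [t t0 tid] := limit_near_id x Pq e8.
have [d [d0 d1 dt xd]] : exists d : R, [/\ 0 < d, d <= 1, d <= t &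
    q (T d x - x - d *: y) <= e / 8 * d].
  near (0 : R)^'+ => d; exists d; split; near: d.
  - exact: nbhs_right_gt.
  - exact: nbhs_right_le.
  - exact: nbhs_right_le.
  - exact: der.
(* The tolerance for f - x carries a factor d because this difference gets divided by d in the
   second component. *)
have ed : 0 < e * d / 16 by rewrite divr_gt0// mulr_gt0.
have [f Af fx] := Ad x _ _ Pq' ed.
have [w] := AG _ _ Af (lexx 0); rewrite limit0 => fw.
have Tq s z : 0 <= s <= 1 -> q (T s z) <= q' z.
  by move=> s01; exact: (limit_bound _ Pq qq' s01).
have [t1 t10 fd] := limit_derivative fw Pq' e8.
(* The mesh [n] is at most [t1], where the expansion of T at [f] is valid; its relative error e / 8
   does not accumulate over the N steps. *)
pose N := (Num.truncn (d / t1)).+1; pose n := d / N%:R.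
have N0 : 0 < N%:R :> R by rewrite ltr0n.
have n0 : 0 < n by rewrite divr_gt0.
have nN : N%:R * n = d by rewrite mulrC divfK// gt_eqF.
have nt1 : n <= t1.
  rewrite ler_pdivrMr// mulrC -ler_pdivrMr//; apply: ltW.
  by have /andP[] := truncn_itv (ltW (divr_gt0 d0 t10)).
have {}fd : q' (T n f - f - n *: w) <= e / 8 * n by apply: fd; rewrite n0.
have qfx : q (f - x) <= e * d / 16.
  by rewrite -(limit0 (f - x)); apply: le_trans (Tq _ _ _) fx; rewrite lexx ler01.
(* The pair [v] is the left Riemann sum with m nodes; its second component telescopes to T(m n) f -
   f up to the error of each step. *)
have ex m : (m <= N)%N -> exists v, [/\ graph_closure G v,
    q (v.1 - (m%:R * n) *: x) <= m%:R * n * (e / 4) &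
    q (v.2 - (T (m%:R * n) f - f)) <= m%:R * n * (e / 8)].
  elim: m => [_|m IHm mN].
    exists 0; split=> //=; rewrite !mul0r ?scale0r ?limit0 !subrr;
    by rewrite rseminorm0.
  have [v [Gv v1 v2]] := IHm (ltnW mN).
  have mn0 : 0 <= m%:R * n by rewrite mulr_ge0// ltW.
  have mnd : m%:R * n <= d by rewrite -nN ler_pM2r// ler_nat ltnW.
  have mn1 : 0 <= m%:R * n <= 1 by rewrite mn0 (le_trans mnd).
  have Tl := limit_linear mn0.
  have [w' Gs] := AG _ _ Af mn0.
  have {}Gs : graph_closure G (T (m%:R * n) f, T (m%:R * n) w).
    by rewrite -(limit_graph_closure mn0 fw Gs).
  exists (n *: (T (m%:R * n) f, T (m%:R * n) w) + v); split; first exact: GL.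
    have -> : (n *: (T (m%:R * n) f, T (m%:R * n) w) + v).1 - (m.+1%:R * n) *: x =
        v.1 - (m%:R * n) *: x + (n *: (T (m%:R * n) (f - x) +
        (T (m%:R * n) x - x))).
      by rewrite (rlinearB _ _ Tl) -natr1 /=; lmod.
    apply: le_trans (qD _ _) _; rewrite -natr1 mulrDl [leRHS]mulrDl lerD//.
    rewrite mul1r qZ gtr0_norm// ler_pM2l//; apply: le_trans (qD _ _) _.
    have := Tq _ (f - x) mn1; have := tid (m%:R * n).
    rewrite mn0 (le_trans mnd dt) => /(_ isT).
    have : e * d / 16 <= e / 16 by rewrite ler_pM2r ?invr_gt0// ger_pMr.
    move: fx; lra.
  have -> : (n *: (T (m%:R * n) f, T (m%:R * n) w) + v).2 -
      (T (m.+1%:R * n) f - f) =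
      v.2 - (T (m%:R * n) f - f) - T (m%:R * n) (T n f - f - n *: w).
    rewrite !(rlinearB _ _ Tl) (rlinearZ _ _ Tl) -(limit_semigroup f mn0 (ltW n0)).
    by rewrite -natr1 [(_ + 1) * n]mulrDl mul1r /=; lmod.
  apply: le_trans (rseminormB _ _ sq) _; rewrite -natr1 mulrDl [leRHS]mulrDl.
  by rewrite lerD// mul1r [leRHS]mulrC; exact: le_trans (Tq _ _ mn1) fd.
have [v [Gv v1 v2]] := ex N (leqnn N); rewrite nN in v1 v2.
exists (d^-1 *: v + 0); split; first exact: GL.
  rewrite -(ler_pM2l d0) -[X in X * q _]gtr0_norm// -qZ addr0 scalerBr /=.
  rewrite scalerA divff ?gt_eqF// scale1r; apply: le_trans v1 _.
  by rewrite ler_pM2l//; lra.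
rewrite -(ler_pM2l d0) -[X in X * q _]gtr0_norm// -qZ addr0 scalerBr /=.
rewrite scalerA divff ?gt_eqF// scale1r.
have -> : v.2 - d *: y = v.2 - (T d f - f) +
    (T d (f - x) + ((T d x - x - d *: y) - (f - x))).
  by rewrite (rlinearB _ _ (limit_linear (ltW d0))); lmod.
apply: le_trans (qD _ _) _; apply: le_trans (lerD (lexx _) (qD _ _)) _.
apply: le_trans (lerD (lexx _) (lerD (lexx _) (rseminormB _ _ sq))) _.
have := Tq d (f - x); rewrite (ltW d0) d1 => /(_ isT).
move: v2 xd qfx fx (mulr_gt0 e0 d0); lra.
Unshelve. all: by end_near. Qed.

End LimitSemigroup.

(** * Construction of a solution curve by compactness *)

Section Existence.
Variables (f w0 : V) (t : R).
Hypotheses (Gf : G (f, w0)) (t0 : 0 < t).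

(** Telescoping with w = 0 from [f] itself, after [q1] has absorbed the iterations common to both
    times. The summand h accounts for the integer parts. *)
Lemma orbit_lipschitz q (S : R) : P q -> 0 <= S ->
  exists2 L : R, 0 < L & \forall h \near 0^'+, forall s s' : R, 0 <= s <= s' -> s' <= S ->
    q (iter (steps s' h) (F h) f - iter (steps s h) (F h) f) <= (s' - s + h) * L.
Proof.
move=> Pq S0; have [q1 Pq1 qq1] := Feq Pq S0; have [q2 Pq2 qq2] := Feq Pq1 S0.
have [q20 q2D q2Z] := Psemi Pq2; have sq1 := Psemi Pq1.
exists (q2 w0 + 1); first by rewrite ltr_pwDr.
near=> h => s s' /andP[s0 ss'] s'S.
have h0 : 0 < h by near: h; exact: nbhs_right_gt.
have Fh := Fl (ltW h0); have s'0 := le_trans s0 ss'.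
have nn := steps_homo (ltW h0) ss'.
set n := (steps s' h - steps s h)%N.
have nE : steps s' h = (steps s h + n)%N by rewrite addnC subnK.
have nS i : (i <= steps s' h)%N -> i%:R * h <= S.
  move=> i_n; apply: le_trans s'S; apply: le_trans (steps_le s'0 h0).
  by rewrite ler_pM2r// ler_nat.
rewrite nE iterD -(rlinearB _ _ (rlinear_iter _ Fh)).
apply: le_trans (qq1 _ _ _ (ltW h0) (nS _ nn)) _.
have step : q2 (F h f - f - h *: 0) <= h * (q2 w0 + 1).
  rewrite scaler0 subr0 -[X in q2 X](subrK (h *: w0)).
  apply: le_trans (q2D _ _) _; rewrite mulrDr addrC lerD//.
    by rewrite q2Z gtr0_norm.
  rewrite mulrC; near: h; exact: (Fder Gf).
have := @iter_increment_bound _ _ (F h) q1 q2 n h _ 0 f 0 Fh sq1 (ltW h0) _ step.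
rewrite scaler0 subr0 mulr0 addr0 mulrA => inc.
apply: le_trans (inc _ _) _.
- move=> j y jn; apply: qq2; first exact: ltW.
  by apply: nS; rewrite nE; apply: leq_trans (ltnW jn) (leq_addl _ _).
- by move=> j _; rewrite subr0 (rlinear0 (rlinear_iter j Fh)) rseminorm0.
rewrite ler_pM2r ?ltr_pwDr//.
have := steps_le s'0 h0; have := steps_gt s0 h0.
by rewrite nE natrD mulrDl; lra.
Unshelve. all: by end_near. Qed.

Let u (n : nat) (s : R) : V := iter (steps s (t / n.+1%:R)) (F (t / n.+1%:R)) f.

Definition seminorm_cvg (x : nat -> V) (l : V) : Prop := forall q (e : R),
  P q -> 0 < e -> \forall n \near \oo, q (x n - l) <= e.

Hypothesis u_compact : forall (s : R) i, 0 <= s -> increasing_seq i ->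
  exists2 j, increasing_seq j & exists l, seminorm_cvg (fun n => u (i (j n)) s) l.
Hypothesis u_dom : forall (s : R) i l, 0 <= s -> increasing_seq i ->
  seminorm_cvg (fun n => u (i n) s) l -> exists w, graph_closure G (l, w).

(** The rationals are enumerated by [unpickle]; the requirement is void for an index that encodes no
    rational or a negative one. *)
Let u_rational : exists2 d, increasing_seq d &
  forall r : rat, 0 <= ratr r :> R -> exists l, seminorm_cvg (fun n => u (d n) (ratr r)) l.
Proof.
pose Q k i := forall r : rat, unpickle k = Some r -> 0 <= ratr r :> R ->
  exists l, seminorm_cvg (fun n => u (i n) (ratr r)) l.
have [||d dd dQ] := @diagonal_subsequence Q.
- move=> k i ii; rewrite /Q; case: (unpickle k) => [r|]; last by exists id.
  have [r0|r0] := leP 0 (ratr r : R).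
    have [j ij [l ul]] := u_compact r0 ii; exists j => // _ [<-] _.
    by exists l.
  by exists id => // _ [<-]; rewrite leNgt r0.
- move=> k m i g d ig Qi dig r kr r0; have [l il] := Qi r kr r0.
  exists l => q e Pq e0; have /(increasing_seq_near ig) [N _ H] := il q e Pq e0.
  exists (N + m)%N => // n /= Nn; have mn : (m <= n)%N.
    exact: leq_trans (leq_addl _ _) Nn.
  by rewrite -(subnK mn) dig; apply: H => /=; rewrite leq_subRL// addnC.
by exists d => // r; apply: (dQ (pickle r)); exact: pickleK.
Qed.

Let u_limit : exists2 d, increasing_seq d &
  forall s : R, 0 <= s -> exists l, seminorm_cvg (fun n => u (d n) s) l.
Proof.
have [d dd dr] := u_rational; exists d => // s s0.
have [|l ul] := @Pcomplete (u (d n) s @[n --> \oo]) _; last first.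
  by exists l => q e Pq e0; exact: ul.
move=> q e Pq e0; have sq := Psemi Pq.
have e8 : 0 < e / 8 by rewrite divr_gt0.
have [L L0 lip] := orbit_lipschitz Pq (addr_ge0 s0 ler01).
have c0 : 0 < Num.min 1 (e / 8 / L) by rewrite lt_min ltr01 !divr_gt0.
(* A rational time to the right of s is nonnegative, stays below the horizon s + 1, and is so close
   that the Lipschitz bound makes the orbit at s Cauchy. *)
have /rat_in_itvoo[r] : s < s + Num.min 1 (e / 8 / L) by rewrite ltrDl.
rewrite in_itv /= => /andP[sr]; rewrite -ltrBlDl lt_min => /andP[r1 rL].
have r0 : 0 <= ratr r :> R by apply: ltW; exact: le_lt_trans sr.
have [l ul] := dr r r0.
exists [set z | q (z - l) <= e / 2]; last first.
  move=> a b /= al bl; apply: le_trans (rseminorm_tri l _ _ sq) _.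
  by rewrite (rseminormBC l)//; lra.
rewrite nbhs_simpl /=; near=> n.
apply: le_trans (rseminorm_tri (u (d n) (ratr r)) _ _ sq) _.
have : q (u (d n) (ratr r) - l) <= e / 8 by near: n; exact: ul.
have hL : t / (d n).+1%:R < e / 8 / L.
  near: n; apply: (steplength_near (A := fun h => h < _) t0 dd).
  by apply: nbhs_right_lt; rewrite divr_gt0.
have /(_ s (ratr r)) : forall s' s'', 0 <= s' <= s'' -> s'' <= s + 1 ->
    q (u (d n) s'' - u (d n) s') <= (s'' - s' + t / (d n).+1%:R) * L.
  near: n; exact: (steplength_near t0 dd lip).
rewrite s0 (ltW sr) => /(_ isT).
have -> : ratr r <= s + 1 by rewrite -lerBlDl ltW.
move=> /(_ isT); rewrite [q (u _ s - _)]rseminormBC//.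
have : (ratr r - s + t / (d n).+1%:R) * L <= e / 8 + e / 8.
  by rewrite -ler_pdivlMr// mulrDl lerD// ltW.
move=> b1 /le_trans/(_ b1); lra.
Unshelve. all: by end_near. Qed.

(** The pointwise limit of the extracted orbits is left continuous by [orbit_lipschitz], and
    inherits its right derivatives from the expansion of the iterates at [v s], which lies in the
    domain by [u_dom]. *)
Lemma mild_solution_exists : exists v,
  [/\ mild_solution v, left_continuous v & v 0 = f].
Proof.
have [d dd dl] := u_limit.
have /choice[v vl] (s : R) : exists l, 0 <= s -> seminorm_cvg (fun n => u (d n) s) l.
  have [s0|s0] := leP 0 s; last by exists 0.
  by have [l ul] := dl s s0; exists l.
exists v; split.
- move=> s s0; have [w vw] := u_dom s0 dd (vl s s0).
  exists w => // q e Pq e0; have e2 : 0 < e / 2 by rewrite divr_gt0.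
  have sq := Psemi Pq; have [q0 qD qZ] := sq.
  have [t1 t10 der] := graph_closure_derivative vw Pq e2.
  exists t1 => // s' s't; have /andP[s'0 _] := s't.
  have ss'0 : 0 <= s + s' by rewrite addr_ge0// ltW.
  have [q' Pq' qq'] := Feq Pq ss'0.
  have es8 : 0 < e * s' / 8 by rewrite divr_gt0// mulr_gt0.
  have w1 : 0 < q w + 1 by rewrite ltr_pwDr.
  near \oo => n.
  have hs' : t / (d n).+1%:R < s'.
    near: n; apply: (steplength_near (A := fun h => h < _) t0 dd).
    exact: nbhs_right_lt.
  have hw : t / (d n).+1%:R < e * s' / 8 / (q w + 1).
    near: n; apply: (steplength_near (A := fun h => h < _) t0 dd).
    by apply: nbhs_right_lt; rewrite divr_gt0.
  set h := t / (d n).+1%:R in hs' hw.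
  have h0 : 0 < h by rewrite divr_gt0.
  have Fh := Fl (ltW h0).
  have sss' : s <= s + s' by rewrite lerDl ltW.
  have ns := steps_homo (ltW h0) sss'.
  set m := (steps (s + s') h - steps s h)%N.
  have mE : steps (s + s') h = (m + steps s h)%N by rewrite subnK.
  have mh : m%:R * h <= s' + h.
    by have := steps_le ss'0 h0; have := steps_gt s0 h0; rewrite mE natrD mulrDl; lra.
  have mh' : s' <= m%:R * h + h.
    by have := steps_gt ss'0 h0; have := steps_le s0 h0; rewrite mE natrD mulrDl; lra.
  (* The orbit at time s + s' is the orbit at time s after m more iterations. Apart from the
     expansion at [v s], every term vanishes as n grows. *)
  have -> : v (s + s') - v s - s' *: w = - (u (d n) (s + s') - v (s + s')) +
    (iter m (F h) (u (d n) s - v s) +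
    (iter m (F h) (v s) - v s - (m%:R * h) *: w + (m%:R * h - s') *: w)).
    rewrite (rlinearB _ _ (rlinear_iter m Fh)) -iterD -mE -/h; lmod.
  apply: le_trans (qD _ _) _.
  apply: le_trans (lerD (lexx _) (qD _ _)) _.
  apply: le_trans (lerD (lexx _) (lerD (lexx _) (qD _ _))) _.
  have : q (- (u (d n) (s + s') - v (s + s'))) <= e * s' / 8.
    by rewrite rseminormN//; near: n; exact: (vl _ ss'0).
  have : q (iter m (F h) (u (d n) s - v s)) <= e * s' / 8.
    apply: (@le_trans _ _ (q' (u (d n) s - v s))); last first.
      by near: n; exact: (vl _ s0).
    apply: qq'; first exact: ltW.
    apply: le_trans (steps_le ss'0 h0); rewrite ler_pM2r// ler_nat mE.
    exact: leq_addr.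
  have : q (iter m (F h) (v s) - v s - (m%:R * h) *: w) <= e / 2 * s'.
    have : m%:R * h <= 2 * s' by lra.
    by move: (m); rewrite /h; near: n; exact: (steplength_near t0 dd (der _ s't)).
  have : q ((m%:R * h - s') *: w) <= e * s' / 8.
    rewrite qZ; apply: (@le_trans _ _ (h * (q w + 1))).
      apply: ler_pM => //; last by rewrite lerDl.
      by rewrite ler_norml; lra.
    by rewrite -ler_pdivlMr// ltW.
  move: (mulr_gt0 e0 s'0); lra.
- move=> q s e Pq e0; have sq := Psemi Pq.
  have [L L0 lip] := orbit_lipschitz Pq (normr_ge0 s).
  exists (e / L); first exact: divr_gt0.
  move=> s' /andP[s'0 s's] ss'; have s0 := le_trans s'0 s's.
  apply/ler_addgt0Pr => c c0; have c4 : 0 < c / 4 by rewrite divr_gt0.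
  near \oo => n.
  have hL : t / (d n).+1%:R < c / 4 / L.
    near: n; apply: (steplength_near (A := fun h => h < _) t0 dd).
    by apply: nbhs_right_lt; rewrite divr_gt0.
  apply: le_trans (rseminorm_tri (u (d n) s') _ _ sq) _.
  apply: le_trans (lerD (lexx _) (rseminorm_tri (u (d n) s) _ _ sq)) _.
  rewrite rseminormBC// (rseminormBC (u (d n) s') (u (d n) s))//.
  have : q (u (d n) s' - v s') <= c / 4 by near: n; exact: (vl _ s'0).
  have : q (u (d n) s - v s) <= c / 4 by near: n; exact: (vl _ s0).
  have /(_ s' s) : forall s' s'', 0 <= s' <= s'' -> s'' <= `|s| ->
      q (u (d n) s'' - u (d n) s') <= (s'' - s' + t / (d n).+1%:R) * L.
    by near: n; exact: (steplength_near t0 dd lip).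
  rewrite s'0 s's ger0_norm// lexx => /(_ isT isT).
  have : (s - s' + t / (d n).+1%:R) * L <= e + c / 4.
    by rewrite -ler_pdivlMr// mulrDl lerD// ltW.
  move=> b1 /le_trans/(_ b1); lra.
- apply/eqP; rewrite -subr_eq0; apply/eqP/Psep => q Pq.
  have sq := Psemi Pq; have [q0 _ _] := sq.
  apply/eqP; rewrite eq_le q0 andbT; apply/ler_addgt0Pr => e e0; rewrite add0r.
  near \oo => n; rewrite rseminormBC//.
  have -> : f - v 0 = u (d n) 0 - v 0 by rewrite /u /steps mul0r truncn0.
  by near: n; exact: (vl _ (lexx _)).
Unshelve. all: by end_near. Qed.

End Existence.

End Consistency.

(** * Passage between the scalar field and real scalars *)

Section RealScaling.
Context (R : realType) (k : scalar_kind).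
Local Notation K := (scalars R k).
Local Notation "r %:K" := (of_real k r) (at level 2, format "r %:K").
Implicit Types r s : R.

Lemma of_realD r s : (r + s)%:K = r%:K + s%:K.
Proof. by case: k => //=; rewrite rmorphD. Qed.

Lemma of_realM r s : (r * s)%:K = r%:K * s%:K.
Proof. by case: k => //=; rewrite rmorphM. Qed.

Lemma of_real1 : (1 : R)%:K = 1.
Proof. by case: k. Qed.

Lemma of_real0 : (0 : R)%:K = 0.
Proof. by case: k. Qed.

Lemma of_real_inj : injective (@of_real R k).
Proof. by case: k => // r s []. Qed.

Lemma normr_of_real r : `|r%:K| = `|r|%:K.
Proof. by case: k => //=; rewrite normc_def /= expr0n /= addr0 sqrtr_sqr. Qed.

Lemma ler_of_real r s : (r%:K <= s%:K) = (r <= s).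
Proof. by case: k => //=; rewrite lecR. Qed.

Lemma gt0_of_real (a : K) : 0 < a -> exists2 r, 0 < r & a = r%:K.
Proof.
case: k a => [a a0|/= [x y]]; first by exists a.
by rewrite ltcE /= => /andP[/eqP-> x0]; exists x.
Qed.

(** In the complex case phi u = l u - i l (i u); the two terms account for the bound c + c. *)
Lemma real_linear_extension (E : lmodType K) (l : E -> R) :
  (forall r u v, l (r%:K *: u + v) = r * l u + l v) ->
  exists phi : E -> K, [/\ forall a u v, phi (a *: u + v) = a * phi u + phi v,
    forall u, (forall a, l (a *: u) = 0) -> phi u = 0,
    forall u, phi u = 0 -> l u = 0 &
    forall u (c : R), (forall a, `|a| <= 1 -> `|l (a *: u)| <= c) ->
      `|phi u| <= (c + c)%:K].
Proof.
case: k E l => /= E l lL.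
  exists l; split=> // [u /(_ 1)|u c lc]; first by rewrite scale1r.
  have := lc 1; rewrite scale1r normr1 lexx => /(_ isT) luc.
  by rewrite -[leLHS]addr0 lerD//; exact: le_trans luc.
have l0 : l 0 = 0.
  have := lL 1 0 0; rewrite scaler0 addr0 mul1r => /eqP.
  by rewrite -subr_eq0 opprD addNKr oppr_eq0 => /eqP.
have lD u v : l (u + v) = l u + l v by have := lL 1 u v; rewrite scale1r mul1r.
have lZ r u : l (r%:C%C *: u) = r * l u by have := lL r u 0; rewrite l0 !addr0.
exists (fun u => Complex (l u) (- l ('i%C *: u))); split.
- move=> [x y] u v.
  rewrite scalerDr !lD.
  have xyE : Complex x y = x%:C%C + y%:C%C * 'i%C :> R[i].
    by apply/eqP; rewrite eq_complex /=; apply/andP; split; apply/eqP; ring.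
  have ixyE : 'i%C * Complex x y = x%:C%C * 'i%C + (- y)%:C%C :> R[i].
    by apply/eqP; rewrite eq_complex /=; apply/andP; split; apply/eqP; ring.
  rewrite scalerA ixyE xyE !scalerDl -!scalerA !lD !lZ -xyE.
  apply/eqP; rewrite eq_complex /=; apply/andP; split; apply/eqP; ring.
- move=> u lu; have := lu 1; rewrite scale1r => ->.
  by have := lu 'i%C => ->; rewrite oppr0.
- by move=> u [].
- move=> u c lc.
  have -> : Complex (l u) (- l ('i%C *: u)) =
      (l u)%:C%C - 'i%C * (l ('i%C *: u))%:C%C :> R[i].
    by apply/eqP; rewrite eq_complex /=; apply/andP; split; apply/eqP; ring.
  apply: le_trans (ler_normB _ _) _.
  have i1 : `|'i%C| = 1 :> R[i].
    by rewrite normc_def /= expr0n expr1n add0r sqrtr1.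
  rewrite normrM i1 mul1r !normc_def /= !expr0n /= !addr0 !sqrtr_sqr -rmorphD lecR.
  by rewrite lerD//; [have := lc 1|have := lc 'i%C];
     rewrite ?scale1r ?i1 ?normr1 lexx; exact.
Qed.

End RealScaling.

(** An alias that carries the real module structure without disturbing the one over K. The
    Hahn-Banach theorem and the product formulas are applied to it. *)
Definition realified (R : realType) (k : scalar_kind) (E : lmodType (scalars R k)) :
  Type := E.

Section Realified.
Context (R : realType) (k : scalar_kind) (E : lmodType (scalars R k)).
Local Notation Er := (realified E).

HB.instance Definition _ := GRing.Zmodule.on Er.

Let rscale (r : R) (x : Er) : Er := of_real k r *: (x : E).

Let rscaleA a b v : rscale a (rscale b v) = rscale (a * b) v.
Proof. by rewrite /rscale scalerA of_realM. Qed.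
Let rscale1 : left_id 1 rscale.
Proof. by move=> x; rewrite /rscale of_real1 scale1r. Qed.
Let rscaleDr : right_distributive rscale +%R.
Proof. by move=> r x y; rewrite /rscale scalerDr. Qed.
Let rscaleDl v : {morph rscale^~ v : a b / a + b}.
Proof. by move=> a b; rewrite /rscale of_realD scalerDl. Qed.

HB.instance Definition _ := GRing.Zmodule_isLmodule.Build R Er
  rscaleA rscale1 rscaleDr rscaleDl.

Lemma realifiedZ (r : R) (x : Er) : r *: x = of_real k r *: (x : E) :> E.
Proof. by []. Qed.

End Realified.

(** * Locally convex topologies and seminorms *)

Section SeminormTopology.
Context (R : realType) (k : scalar_kind).
Local Notation K := (scalars R k).
Context (X : tvsType K) (Omega : Type) (p : Omega -> X -> R).
Hypothesis hp : generating_seminorms p.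
Implicit Types (q : X -> R) (x y : X) (e : R).

(** Unlike the generating family, this one is stable under sums and positive multiples, so a single
    seminorm can stand for the finite families in neighbourhoods and in equicontinuity. *)
Definition dominated_seminorms : set (X -> R) := [set q | seminorm q /\
  exists n (c : 'I_n -> Omega) (b : 'I_n -> R),
    (forall i, 0 < b i) /\ forall x, q x <= \sum_(i < n) b i * p (c i) x].
Local Notation P := dominated_seminorms.

Lemma seminorm_rseminorm q : seminorm q -> rseminorm (q : realified X -> R).
Proof.
case=> q0 qD qZ; split=> // r x; apply: (@of_real_inj R k).
by rewrite realifiedZ qZ normr_of_real of_realM.
Qed.

Lemma dominated_rseminorm q : P q -> rseminorm (q : realified X -> R).
Proof. by case=> /seminorm_rseminorm. Qed.

Lemma dominated_generator a : P (p a).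
Proof.
split; first exact: hp.1.
exists 1%N, (fun=> a), (fun=> 1); split=> // x.
by rewrite big_ord1 mul1r.
Qed.

Lemma seminormS q1 q2 : seminorm q1 -> seminorm q2 ->
  seminorm (fun x => q1 x + q2 x).
Proof.
case=> q10 q1D q1Z [q20 q2D q2Z]; split=> [x|x y|a x]; first exact: addr_ge0.
  by rewrite addrACA lerD.
by rewrite !of_realD q1Z q2Z mulrDr.
Qed.

Lemma dominatedD q1 q2 : P q1 -> P q2 -> P (fun x => q1 x + q2 x).
Proof.
move=> [s1 [n1 [c1 [b1 [b10 q1b]]]]] [s2 [n2 [c2 [b2 [b20 q2b]]]]].
split; first exact: seminormS.
exists (n1 + n2)%N, (fun i => match fintype.split i with inl j => c1 j | inr j => c2 j end),
  (fun i => match fintype.split i with inl j => b1 j | inr j => b2 j end).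
split=> [i|x]; first by case: (fintype.split i).
rewrite big_split_ord /= lerD//.
  apply: le_trans (q1b x) _; rewrite le_eqVlt; apply/orP; left; apply/eqP.
  by apply: eq_bigr => i _; rewrite (unsplitK (inl i)).
apply: le_trans (q2b x) _; rewrite le_eqVlt; apply/orP; left; apply/eqP.
by apply: eq_bigr => i _; rewrite (unsplitK (inr i)).
Qed.

Lemma dominatedZ (c : R) q : 0 < c -> P q -> P (fun x => c * q x).
Proof.
move=> c0 [[q0 qD qZ] [n [d [b [b0 qb]]]]]; split.
  split=> [x|x y|a x]; first by rewrite mulr_ge0// ltW.
    by rewrite -mulrDr ler_pM2l.
  by rewrite !of_realM qZ mulrCA.
exists n, d, (fun i => c * b i); split=> [i|x]; first exact: mulr_gt0.
rewrite (eq_bigr (fun i => c * (b i * p (d i) x))); last first.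
  by move=> i _; rewrite mulrA.
by rewrite -mulr_sumr ler_pM2l.
Qed.

Lemma dominated0 : P (fun=> 0).
Proof.
have c : 'I_0 -> Omega by case.
split; last by exists 0%N, c, (fun=> 1); split=> // x; rewrite big_ord0.
by split=> // [*|*]; rewrite ?addr0// of_real0 mulr0.
Qed.

Lemma dominated_sum n (q : 'I_n -> X -> R) : (forall i, P (q i)) ->
  P (fun x => \sum_(i < n) q i x).
Proof.
elim: n q => [|n IHn] q Pq.
  by rewrite (_ : (fun _ => _) = fun=> 0); [exact: dominated0|apply/funext => x; rewrite big_ord0].
rewrite (_ : (fun _ => _) = fun x => q ord0 x + \sum_(i < n) q (lift ord0 i) x).
  by apply: dominatedD => //; exact: IHn.
by apply/funext => x; rewrite big_ord_recl.
Qed.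

Lemma equicontinuous_dominated (Gs : set (X -> X)) q :
  equicontinuous_family p Gs -> P q ->
  exists2 q', P q' & forall g x, Gs g -> q (g x) <= q' x.
Proof.
move=> eqc [sq [n [c [b [b0 qb]]]]].
have /choice[r Hr] a : exists r, P r /\ forall g x, Gs g -> p a (g x) <= r x.
  have [m [d [b' [b'0 H]]]] := eqc a.
  exists (fun x => \sum_(i < m) b' i * p (d i) x); split.
    by apply: dominated_sum => i; apply: dominatedZ => //; exact: dominated_generator.
  by move=> g x Gg; exact: H.
exists (fun x => \sum_(i < n) b i * r (c i) x).
  by apply: dominated_sum => i; apply: dominatedZ => //; exact: (Hr _).1.
move=> g x Gg; apply: le_trans (qb _) _; apply: ler_sum => i _.
by rewrite ler_pM2l//; exact: (Hr _).2.
Qed.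

Lemma nbhs_dominated x (A : set X) :
  nbhs x A <-> exists2 q, P q & forall y, q (y - x) <= 1 -> A y.
Proof.
split=> [/(hp.2 x A)[n [a [e [e0 sA]]]]|[q [sq [n [c [b [b0 qb]]]]] qA]].
  have e2 : 0 < 2 / e by rewrite divr_gt0.
  (* The factor 2 / e gives p (a i) (y - x) <= e / 2 on the closed unit ball, hence the strict
     inequality. *)
  exists (fun y => \sum_(i < n) 2 / e * p (a i) y).
    by apply: dominated_sum => i; apply: dominatedZ => //; exact: dominated_generator.
  move=> y; rewrite -mulr_sumr -ler_pdivlMl// mulr1 invf_div => ye.
  apply: sA => i; apply: (@le_lt_trans _ _ (e / 2)).
    apply: le_trans ye; rewrite (bigD1 i)//= lerDl sumr_ge0// => j _.
    by have [] := hp.1 (a j).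
  by rewrite ltr_pdivrMr// ltr_pMr// ltr1n.
apply/(hp.2 x A); exists n, c.
have b1 : 0 < \sum_(i < n) b i + 1.
  by rewrite ltr_pwDr// sumr_ge0// => i _; exact: ltW.
(* The summand 1 keeps the radius meaningful when n = 0. *)
exists (\sum_(i < n) b i + 1)^-1; split; first by rewrite invr_gt0.
move=> y /= ye; apply: qA; apply: le_trans (qb _) _.
apply: (@le_trans _ _ (\sum_(i < n) b i * (\sum_(i < n) b i + 1)^-1)).
  by apply: ler_sum => i _; rewrite ler_pM2l// ltW.
by rewrite -mulr_suml ler_pdivrMr// mul1r lerDl.
Qed.

Lemma nbhs_seminorm_ball q x e : P q -> 0 < e -> nbhs x [set y | q (y - x) <= e].
Proof.
move=> Pq e0; apply/nbhs_dominated.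
exists (fun y => e^-1 * q y); first by apply: dominatedZ; rewrite // invr_gt0.
by move=> y /=; rewrite ler_pdivrMl// mulr1.
Qed.

Lemma cvg_dominated (Fi : set_system X) {FF : Filter Fi} x :
  Fi --> x <-> forall q e, P q -> 0 < e -> Fi [set y | q (y - x) <= e].
Proof.
split=> [Fx q e Pq e0|H A /= /nbhs_dominated[q Pq qA]].
  exact/Fx/nbhs_seminorm_ball.
by apply: filterS (H q 1 Pq ltr01) => y; exact: qA.
Qed.

Lemma fmap_cvg_dominated (I : Type) (Fi : set_system I) {FF : Filter Fi}
  (f : I -> X) x :
  f @ Fi --> x <-> forall q e, P q -> 0 < e -> \forall i \near Fi, q (f i - x) <= e.
Proof. exact: cvg_dominated. Qed.

Lemma closure_dominated (A : set (X * X)) :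
  closure A = graph_closure (V := realified X) P A.
Proof.
apply/seteqP; split=> -[x y] /=.
  move=> cA q e Pq e0; have [|v [Av [/= v1 v2]]] := cA [set z |
     (q (z.1 - x) <= e) /\ (q (z.2 - y) <= e)].
    by exists ([set z | q (z - x) <= e], [set z | q (z - y) <= e]);
      [split; exact: nbhs_seminorm_ball|case].
  by exists v.
move=> cA B [[B1 B2] /= [/nbhs_dominated[q1 Pq1 q1B] /nbhs_dominated[q2 Pq2 q2B]] sB].
have [v [Av v1 v2]] := cA _ 1 (dominatedD Pq1 Pq2) ltr01.
exists v; split=> //; apply: sB; split => /=.
  apply: q1B; apply: le_trans v1; rewrite lerDl; by case: Pq2 => -[].
apply: q2B; apply: le_trans v2; rewrite lerDr; by case: Pq1 => -[].
Qed.

Lemma dense_dominated (A : set X) :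
  dense A <-> forall x q e, P q -> 0 < e -> exists2 y, A y & q (y - x) <= e.
Proof.
split=> [dA x q e Pq e0|H O [x Ox] oO].
  have [||y [/interior_subset/= yx Ay]] := dA (interior [set y | q (y - x) <= e]).
  - by exists x; exact: nbhs_seminorm_ball.
  - exact: open_interior.
  - by exists y.
have /nbhs_dominated[q Pq qO] : nbhs x O by exact: open_nbhs_nbhs.
by have [y Ay yx] := H x q 1 Pq ltr01; exists y; split=> //; exact: qO.
Qed.

Lemma dominated_separated : hausdorff_space X ->
  forall x, (forall q, P q -> q x = 0) -> x = 0.
Proof.
move=> hX x q0; apply: hX => A B /nbhs_singleton Ax /nbhs_dominated[q Pq qB].
by exists x; split=> //; apply: qB; rewrite subr0 q0.
Qed.

Lemma dominated_complete : complete_tvs X -> forall Fi : set_system X,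
  ProperFilter Fi ->
  (forall q e, P q -> 0 < e ->
     exists2 B, Fi B & forall a b, B a -> B b -> q (a - b) <= e) ->
  exists x, forall q e, P q -> 0 < e -> Fi [set a | q (a - x) <= e].
Proof.
move=> cX Fi PF cF; have [|x Fx] := cX Fi PF; last first.
  by exists x => q e Pq e0; apply: Fx; exact: nbhs_seminorm_ball.
move=> A /= /nbhs_dominated[q Pq qA]; have [B FB Bq] := cF q 1 Pq ltr01.
exists (B, B) => //= -[a b] /= [Ba Bb]; apply: qA; rewrite subr0; exact: Bq.
Qed.

End SeminormTopology.

(** * Weak closedness of closed subspaces *)

Section WeakTopology.
Context (R : realType) (k : scalar_kind).
Local Notation K := (scalars R k).
Context (X : tvsType K) (Omega : Type) (p : Omega -> X -> R).
Hypothesis hp : generating_seminorms p.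
Local Notation P := (dominated_seminorms p).

Lemma weakly_cvg_dual (u : nat -> X) (l : X) (phi : dual X) :
  weakly_cvg u l -> sval phi (u n) @[n --> \oo] --> (sval phi l : K^o).
Proof.
move=> /cvg_sup/(_ phi) ul; apply: (cvg_comp _ _ ul).
exact: initial_continuous.
Qed.

Lemma cvg_weakly_cvg (u : nat -> X) (l : X) : u @ \oo --> l -> weakly_cvg u l.
Proof.
move=> ul; apply/cvg_sup => phi A.
rewrite /= (@nbhsE (initial_topology (sval phi))) /= => -[B [[C oC <-] Cl] sBA].
apply: filterS sBA _; apply: ul; apply: (proj2_sig phi).2.
exact: open_nbhs_nbhs.
Qed.

Lemma linear_dominated_continuous (phi : X -> K^o) q : linear phi -> P q ->
  (forall x, `|phi x| <= of_real k (q x)) -> continuous phi.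
Proof.
move=> phil Pq phiq x; apply/cvgrPdist_le => /= _ /gt0_of_real[e e0 ->].
apply: filterS (nbhs_seminorm_ball hp x Pq e0) => y /= yx.
have -> : phi x - phi y = phi (x - y).
  by rewrite -[RHS]addr0; have := phil (- 1) y x; rewrite !scaleN1r [- y + x]addrC => ->;
     rewrite addr0 addrC.
apply: le_trans (phiq _) _; rewrite ler_of_real.
by rewrite (rseminormBC _ _ (dominated_rseminorm Pq)).
Qed.

(** The distance to [G] measured by [q] is sublinear, vanishes on [G] and is at least e at (x, y).
    The Hahn-Banach theorem gives a real functional below it with the same value at (x, y); its
    extension to K, restricted to the two axes, gives [phi] and [psi]. *)
Lemma separate_closed_subspace (G : set (X * X)) (x y : X) :
  linear_subspace (G : set (X * X)%type) -> ~ closure G (x, y) ->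
  exists phi psi : dual X,
    (forall u, G u -> sval phi u.1 + sval psi u.2 = 0) /\
    sval phi x + sval psi y != 0.
Proof.
move=> [G0 GL] /=; rewrite (closure_dominated hp) => /existsNP[q /existsNP[e]].
move=> /not_implyP[Pq] /not_implyP[e0 /forallNP far].
have [[q0 qD qZ] _] := Pq; have sq := dominated_rseminorm Pq.
pose V : lmodType R := (realified X * realified X)%type.
pose d (g v : V) : R := q (v.1 - g.1) + q (v.2 - g.2).
have [||||sd dle dge] := @inf_sublinear R V V (G : set V) d (fun=> 0).
- by exists 0.
- by move=> g v _; rewrite addr_ge0.
- move=> g h u v Gg Gh; exists (g + h).
    by have := GL 1 g h Gg Gh; rewrite scale1r.
  rewrite /d /= !opprD ![_ + _ + (- _ - _)]addrACA.
  by apply: le_trans (lerD (qD _ _) (qD _ _)) _; rewrite addrACA.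
- move=> g r v Gg r0; exists (r *: g).
    by have := GL (of_real k r) g 0 Gg G0; rewrite addr0.
  by rewrite /d /= -!scalerBr; have [_ _ qrZ] := sq; rewrite !qrZ ger0_norm// mulrDr.
have [l [lL ld lxy]] := hahn_banach ((x, y) : V) sd.
have lG (g : X * X) : G g -> l g = 0.
  have le0 h : G h -> l h <= 0.
    move=> Gh; apply: le_trans (ld _) _; apply: le_trans (dle _ _ Gh) _.
    by rewrite /d !subrr (rseminorm0 sq) addr0.
  move=> Gg; apply/eqP; rewrite eq_le le0//=.
  have := le0 _ (GL (- 1) g 0 Gg G0).
  have -> : -1 *: g + 0 = (-1 : R) *: (g : V) + 0.
    by rewrite !scaleN1r.
  rewrite lL mulN1r.
  have -> : l 0 = 0.
    by have := lL (-1) 0 0; rewrite scaler0 addr0 mulN1r addNr.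
  by rewrite addr0 oppr_le0.
have lq u : `|l u| <= q u.1 + q u.2.
  have lu v : l v <= q v.1 + q v.2.
    apply: le_trans (ld _) _; apply: le_trans (dle _ _ G0) _.
    by rewrite /d !subr0.
  rewrite ler_norml lu andbT lerNl.
  have -> : - l u = l (- u).
    have := lL (-1) u 0; rewrite addr0 scaleN1r mulN1r => ->.
    have -> : l 0 = 0; last by rewrite addr0.
    by have := lL (-1) 0 0; rewrite scaler0 addr0 mulN1r addNr.
  by apply: le_trans (lu _) _; rewrite /= !(rseminormN _ sq).
have l0 : l ((x, y) : V) != 0.
  rewrite lxy gt_eqF//; apply: lt_le_trans e0 _.
  apply: lb_le_inf; first by exists (d 0 (x, y)), 0.
  move=> _ [g Gg <-]; rewrite leNgt; apply/negP => dlt; apply: (far g); split=> //.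
    rewrite (rseminormBC _ _ sq); apply: ltW; apply: le_lt_trans dlt.
    by rewrite /d lerDl.
  rewrite (rseminormBC _ _ sq); apply: ltW; apply: le_lt_trans dlt.
  by rewrite /d lerDr.
have [phi [phiL phiG phi0 phiq]] := @real_linear_extension R k (X * X)%type l
  (fun r u v => lL r u v).
have phiD u v : phi (u + v) = phi u + phi v.
  by have := phiL 1 u v; rewrite scale1r mul1r.
have bound (u : X * X) c : q u.1 + q u.2 <= c -> `|phi u| <= of_real k (c + c).
  move=> uc; apply: phiq => a a1; apply: le_trans (lq _) _; apply: le_trans uc.
  have qa z : q (a *: z) <= q z.
    rewrite -(ler_of_real k) qZ; apply: ler_piMl => //.
    by rewrite -(of_real0 R k) ler_of_real.
  by rewrite lerD /=.
have P2 := dominatedD Pq Pq.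
have phi1 : linear (fun z => phi (z, 0) : K^o).
  move=> a z w; rewrite -[RHS]phiL; congr phi.
  by apply/eqP; rewrite -pair_eqE /= scaler0 addr0 !eqxx.
have phi2 : linear (fun z => phi (0, z) : K^o).
  move=> a z w; rewrite -[RHS]phiL; congr phi.
  by apply/eqP; rewrite -pair_eqE /= scaler0 addr0 !eqxx.
have c1 : continuous (fun z => phi (z, 0) : K^o).
  apply: linear_dominated_continuous phi1 P2 _ => z.
  by apply: bound => /=; rewrite (rseminorm0 sq) addr0.
have c2 : continuous (fun z => phi (0, z) : K^o).
  apply: linear_dominated_continuous phi2 P2 _ => z.
  by apply: bound => /=; rewrite (rseminorm0 sq) add0r.
have phiE z w : phi (z, 0) + phi (0, w) = phi (z, w).
  by rewrite -phiD; congr phi; apply/eqP; rewrite -pair_eqE /= addr0 add0r !eqxx.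
exists (exist _ (fun z => phi (z, 0) : K^o) (conj phi1 c1)).
exists (exist _ (fun z => phi (0, z) : K^o) (conj phi2 c2)); split=> /=.
  move=> [z w] Gzw /=; rewrite phiE; apply: phiG => a; apply: lG.
  by have := GL a _ _ Gzw G0; rewrite addr0.
by rewrite phiE; apply: contra_neq l0 => /phi0.
Qed.

(** A separating pair would satisfy phi (u n) + psi (v n) = 0 for every n, and this relation passes
    to the weak limit. *)
Lemma closure_weak_limit (G : set (X * X)) (u v : nat -> X) (x y : X) :
  linear_subspace (G : set (X * X)%type) -> (forall n, G (u n, v n)) ->
  (forall phi : dual X, sval phi (u n) @[n --> \oo] --> (sval phi x : K^o)) ->
  (forall phi : dual X, sval phi (v n) @[n --> \oo] --> (sval phi y : K^o)) ->
  closure G (x, y).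
Proof.
move=> sG Guv ux vy; apply: contrapT.
move=> /(separate_closed_subspace sG)[phi [psi [phiG /negP]]]; apply.
have cv : (sval phi (u n) + sval psi (v n)) @[n --> \oo] -->
    (sval phi x + sval psi y : K^o) by exact: cvgD.
apply/eqP; apply: (cvg_unique _ cv); first exact: norm_hausdorff.
rewrite (_ : (fun n => _) = fun=> 0); first exact: cvg_cst.
by apply/funext => n; exact: (phiG (u n, v n)).
Qed.

End WeakTopology.

(** * Generators and semigroups in terms of seminorms *)

Section Semigroups.
Context (R : realType) (k : scalar_kind).
Local Notation K := (scalars R k).
Context (X : tvsType K) (Omega : Type) (p : Omega -> X -> R).
Hypothesis hp : generating_seminorms p.
Local Notation P := (dominated_seminorms p).
Implicit Types (T : R -> X -> X) (q : X -> R) (x y : X).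

Lemma near0_right (A : R -> Prop) : (\forall h \near 0^'+, A h) ->
  exists2 t, 0 < t & forall h, 0 < h <= t -> A h.
Proof.
move=> [e /= e0 eA]; exists (e / 2); first by rewrite divr_gt0.
move=> h /andP[h0 he]; apply: eA => //=.
rewrite sub0r normrN gtr0_norm//; apply: le_lt_trans he _.
by rewrite ltr_pdivrMr// ltr_pMr// ltr1n.
Qed.

(** The modulus of [a] lives in K whereas seminorms are real-valued; [c] is the real number that
    represents [|a| + 1]. *)
Lemma seminorm_scale_bound (a : K) :
  exists2 c : R, 0 < c & forall q x, seminorm q -> q (a *: x) <= c * q x.
Proof.
have /gt0_of_real[c c0 ac] : 0 < `|a| + 1 by rewrite ltr_pwDr.
exists c => // q x [q0 _ qZ]; rewrite -(ler_of_real k) qZ of_realM -ac.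
by rewrite ler_wpM2r ?lerDl// -(of_real0 R k) ler_of_real.
Qed.

Lemma generatorP T u : generator T u <-> forall q (e : R), P q -> 0 < e ->
  \forall h \near 0^'+, q (T h u.1 - u.1 - of_real k h *: u.2) <= e * h.
Proof.
rewrite /generator /= (cvg_dominated hp).
have eqv q (e h : R) : P q -> 0 < h ->
    (q (of_real k h^-1 *: (T h u.1 - u.1) - u.2) <= e) =
    (q (T h u.1 - u.1 - of_real k h *: u.2) <= e * h).
  move=> /dominated_rseminorm[_ _ qZ] h0.
  have -> : of_real k h^-1 *: (T h u.1 - u.1) - u.2 =
      (h^-1 : R) *: (T h u.1 - u.1 - of_real k h *: u.2 : realified X).
    by rewrite realifiedZ [RHS]scalerBr scalerA -of_realM mulVf ?gt_eqF// of_real1 scale1r.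
  by rewrite qZ gtr0_norm ?invr_gt0// mulrC ler_pdivrMr.
split=> H q e Pq e0; have := H q e Pq e0; rewrite ?nbhs_simpl /= => {}H.
  near=> h; have h0 : 0 < h by near: h; exact: nbhs_right_gt.
  by rewrite -eqv//; near: h.
near=> h; have h0 : 0 < h by near: h; exact: nbhs_right_gt.
by rewrite /= eqv//; near: h.
Unshelve. all: by end_near. Qed.

Lemma closure_subspace (G : set (X * X)) :
  linear_subspace (G : set (X * X)%type) ->
  linear_subspace (closure G : set (X * X)%type).
Proof.
move=> [G0 GL]; split; first exact: subset_closure.
move=> a u v; rewrite (closure_dominated hp) => Gu Gv q e Pq e0.
have [c c0 qc] := seminorm_scale_bound a.
have e2 : 0 < e / 2 by rewrite divr_gt0.
have [u' [Gu' u1 u2]] := Gu q _ Pq (divr_gt0 e2 c0).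
have [v' [Gv' v1 v2]] := Gv q _ Pq e2.
have [sq _] := Pq; have [_ qD _] := sq.
exists (a *: u' + v'); split; first exact: GL.
  change (q (a *: u'.1 + v'.1 - (a *: u.1 + v.1) : X) <= e).
  rewrite opprD addrACA -scalerBr [e]splitr; apply: le_trans (qD _ _) _.
  by rewrite lerD//; apply: le_trans (qc _ _ sq) _; rewrite mulrC -ler_pdivlMr.
change (q (a *: u'.2 + v'.2 - (a *: u.2 + v.2) : X) <= e).
rewrite opprD addrACA -scalerBr [e]splitr; apply: le_trans (qD _ _) _.
by rewrite lerD//; apply: le_trans (qc _ _ sq) _; rewrite mulrC -ler_pdivlMr.
Qed.

Lemma generator_subspace T : (forall s, 0 <= s -> linear (T s)) ->
  linear_subspace (generator T : set (X * X)%type).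
Proof.
move=> Tl; split.
  apply/generatorP => q e Pq e0; near=> h.
  have h0 : 0 < h by near: h; exact: nbhs_right_gt.
  have -> : T h 0 = 0.
    by have := Tl h (ltW h0) (-1) 0 0; rewrite !scaleN1r oppr0 addr0 addNr.
  rewrite /= scaler0 !subr0 (rseminorm0 (dominated_rseminorm Pq)).
  by rewrite mulr_ge0 ?ltW.
move=> a u v /generatorP Gu /generatorP Gv; apply/generatorP => q e Pq e0.
have [c c0 qc] := seminorm_scale_bound a.
have e2 : 0 < e / 2 by rewrite divr_gt0.
have [sq _] := Pq; have [_ qD _] := sq.
near=> h; have h0 : 0 < h by near: h; exact: nbhs_right_gt.
rewrite /= (Tl h (ltW h0)).
have -> : a *: T h u.1 + T h v.1 - (a *: u.1 + v.1) -
    of_real k h *: (a *: u.2 + v.2) = a *: (T h u.1 - u.1 - of_real k h *: u.2) +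
      (T h v.1 - v.1 - of_real k h *: v.2).
  by lmod.
apply: le_trans (qD _ _) _; rewrite [e]splitr mulrDl lerD//; last by near: h; exact: Gv.
apply: le_trans (qc _ _ sq) _; rewrite mulrC -ler_pdivlMr// mulrAC.
by near: h; apply: Gu => //; exact: divr_gt0.
Unshelve. all: by end_near. Qed.

Lemma op_add_subspace (C D : set (X * X)) :
  linear_subspace (C : set (X * X)%type) ->
  linear_subspace (D : set (X * X)%type) ->
  linear_subspace (op_add C D : set (X * X)%type).
Proof.
move=> [C0 CL] [D0 DL]; split; first by exists 0, 0; split=> //; rewrite addr0.
move=> a u v [y [z [Cy Dz uE]]] [y' [z' [Cy' Dz' vE]]].
exists (a *: y + y'), (a *: z + z'); split.
- exact: (CL a _ _ Cy Cy').
- exact: (DL a _ _ Dz Dz').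
- by rewrite /= uE vE scalerDr addrACA.
Qed.

Lemma dom_subspace (C D : set (X * X)) :
  linear_subspace (C : set (X * X)%type) ->
  linear_subspace (D : set (X * X)%type) ->
  linear_subspace (dom C `&` dom D : set X).
Proof.
move=> [C0 CL] [D0 DL]; split; first by split; exists 0.
move=> a x y [[c Cc] [d Dd]] [[c' Cc'] [d' Dd']]; split.
  by exists (a *: c + c'); exact: (CL a _ _ Cc Cc').
by exists (a *: d + d'); exact: (DL a _ _ Dd Dd').
Qed.

(** The families in [class_E] contain positive powers only, so [q] is added to the seminorm to cover
    m = 0. *)
Lemma class_E_bound F q (S : R) : class_E p F -> P q -> 0 <= S ->
  exists2 q', P q' & forall (h : R) m x, 0 <= h -> m%:R * h <= S ->
    q (iter m (F h) x) <= q' x.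
Proof.
move=> [Fl F0 Fe] Pq S0.
have [q' Pq' qq'] := equicontinuous_dominated hp (Fe S S0) Pq.
exists (fun x => q' x + q x); first exact: dominatedD.
move=> h [|m] x h0 mh; first by rewrite lerDr; case: Pq' => -[].
apply: (@le_trans _ _ (q' x)); last by rewrite lerDl; case: Pq => -[].
by apply: qq'; exists 1%N, m.+1, h; rewrite !divr1.
Qed.

Section LC0.
Variable T : R -> X -> X.
Hypothesis TE : lC0_semigroup p T.

Lemma lC0_linear s : 0 <= s -> linear (T s).
Proof. by case: TE => _ _ _ [Tl _ _] /Tl[]. Qed.

Lemma lC0B s x y : 0 <= s -> T s (x - y) = T s x - T s y.
Proof.
by move=> /lC0_linear Tl; have := Tl (-1) y x; rewrite !scaleN1r ![- _ + _]addrC.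
Qed.

Lemma lC0_bound q (S : R) : P q -> 0 <= S ->
  exists2 q', P q' & forall s x, 0 <= s <= S -> q (T s x) <= q' x.
Proof.
move=> Pq S0; case: TE => _ _ _ TE'.
have [q' Pq' qq'] := class_E_bound TE' Pq S0.
by exists q' => // s x /andP[s0 sS]; apply: (qq' s 1%N x s0); rewrite mul1r.
Qed.

Lemma lC0_cvg0 x q (e : R) : P q -> 0 < e ->
  \forall h \near 0^'+, q (T h x - x) <= e.
Proof.
move=> Pq e0; case: TE => Tc T0 _ _.
have /subspace_continuousP/(_ 0) := Tc.
rewrite /= in_itv /= lexx => /(_ isT) /pointwise_cvgP/(_ x) /(cvg_dominated hp).
move=> /(_ q e Pq e0); rewrite /from_subspace /= T0 => -[d /= d0 dT].
exists d => //= h hd h0; apply: dT => //=; by rewrite in_itv /= andbT ltW.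
Qed.

Lemma lC0_generator_invariant s x y : 0 <= s ->
  generator T (x, y) -> generator T (T s x, T s y).
Proof.
move=> s0 /generatorP gT; apply/generatorP => q e Pq e0 /=.
have [q' Pq' qq'] := lC0_bound Pq s0; case: TE => _ _ TD _.
near=> h; have h0 : 0 < h by near: h; exact: nbhs_right_gt.
have TC : T h (T s x) = T s (T h x).
  by rewrite -[LHS]/((T h \o T s) x) -(TD _ _ (ltW h0) s0) addrC (TD _ _ s0 (ltW h0)).
have TZ : of_real k h *: T s y = T s (of_real k h *: y).
  have := lC0_linear s0 (of_real k h) y 0.
  have -> : T s 0 = 0 by rewrite -[0 in LHS](subrr 0) lC0B// subrr.
  by rewrite !addr0.
rewrite TC TZ -!lC0B//; apply: le_trans (qq' _ _ _) _; first by rewrite s0 lexx.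
by near: h; exact: gT.
Unshelve. all: by end_near. Qed.

Lemma lC0_left_continuous x :
  left_continuous (V := realified X) P (fun s => T s x).
Proof.
move=> q s e Pq e0; have [q' Pq' qq'] := lC0_bound Pq (normr_ge0 s).
have sq' := dominated_rseminorm Pq'; case: TE => _ T0 TD _.
have [t t0 tx] := near0_right (lC0_cvg0 x Pq' e0).
exists t => // s' /andP[s'0 s's] st; have s0 := le_trans s'0 s's.
have -> : T s x = T s' (T (s - s') x).
  by rewrite -[RHS]/((T s' \o T (s - s')) x) -TD ?subr_ge0// addrC subrK.
rewrite -[_ - _]/(T s' x - T s' (T (s - s') x)) -lC0B//.
apply: le_trans (qq' _ _ _) _; first by rewrite s'0 ger0_norm.
rewrite (rseminormBC _ _ sq').
have [->|ns] := eqVneq s s'; first by rewrite subrr T0 subrr (rseminorm0 sq') ltW.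
by apply: tx; rewrite st subr_gt0 lt_def ns s's.
Qed.

(** T(s) commutes with the difference quotients, so the right derivative at s is T(s) y. *)
Lemma lC0_mild_solution (G : set (X * X)) x y : closure G = generator T ->
  generator T (x, y) ->
  mild_solution (V := realified X) P G (fun s => T s x).
Proof.
move=> GT Txy s s0; have Tsxy := lC0_generator_invariant s0 Txy.
exists (T s y); first by rewrite -(closure_dominated hp) GT.
move=> q e Pq e0; have /generatorP/(_ q e Pq e0)/near0_right := Tsxy.
case: TE => _ _ TD _ [t t0 tT]; exists t => // s' s't.
have /andP[s'0 _] := s't.
by have := tT s' s't; rewrite /= [s + s']addrC (TD _ _ (ltW s'0) s0).
Qed.

End LC0.
End Semigroups.

(** * The product formula for a sum of generators *)

Section Trotter.
Context (R : realType) (k : scalar_kind).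
Context (X : tvsType (scalars R k)) (Omega : Type) (p : Omega -> X -> R).
Hypotheses (hp : generating_seminorms p) (hausdorffX : hausdorff_space X)
  (completeX : complete_tvs X).
Context (C D : set (X * X)) (expC expD : R -> X -> X).
Hypotheses (hC : generates p C expC) (hD : generates p D expD).
Context (F : R -> X -> X).
Hypotheses (hF : forall s, 0 <= s -> F s = expC s \o expD s)
  (densCD : dense (dom C `&` dom D)) (FE : class_E p F).
Local Notation P := (dominated_seminorms p).
Local Notation G := (op_add C D).
Local Notation Xr := (realified X).

Let Psemi (q : Xr -> R) : P q -> rseminorm q.
Proof. exact: dominated_rseminorm. Qed.

Let Fl h : 0 <= h -> rlinear (F h : Xr -> Xr).
Proof. by case: FE => Fl _ _ /Fl[Fhl _] r x y; exact: Fhl. Qed.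

Let Feq (q : Xr -> R) (S : R) : P q -> 0 <= S ->
  exists2 q' : Xr -> R, P q' & forall (h : R) m (x : Xr), 0 <= h -> m%:R * h <= S ->
    q (iter m (F h) x) <= q' x.
Proof. exact: class_E_bound. Qed.

Let Psep (x : Xr) : (forall q : Xr -> R, P q -> q x = 0) -> x = 0.
Proof. exact: dominated_separated. Qed.
Let Pcomplete (Fi : set_system Xr) : ProperFilter Fi ->
  (forall (q : Xr -> R) (e : R), P q -> 0 < e ->
     exists2 B, Fi B & forall a b, B a -> B b -> q (a - b) <= e) ->
  exists x, forall (q : Xr -> R) (e : R), P q -> 0 < e -> Fi [set a | q (a - x) <= e].
Proof. exact: (dominated_complete hp completeX). Qed.

Let linC s : 0 <= s -> linear (expC s).
Proof. exact: (lC0_linear hC.1). Qed.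

Let subC : linear_subspace (C : set (X * X)%type).
Proof. by case: hC => TE <-; apply: (generator_subspace hp); exact: lC0_linear TE. Qed.

Let subD : linear_subspace (D : set (X * X)%type).
Proof. by case: hD => TE <-; apply: (generator_subspace hp); exact: lC0_linear TE. Qed.

Lemma sum_graph_subspace : linear_subspace (G : set (X * X)%type).
Proof. exact: op_add_subspace. Qed.

Lemma sum_closure_subspace : linear_subspace (closure G : set (X * X)%type).
Proof. exact/(closure_subspace hp)/sum_graph_subspace. Qed.

(** With E = exp(hC), the remainder is E (exp(hD) x - x - h z) + h (E z - z) + (E x - x - h y), and
    each term is o(h). *)
Lemma product_derivative (u : Xr * Xr) (q : Xr -> R) (e : R) : G u -> P q -> 0 < e ->
  \forall h \near 0^'+, q (F h u.1 - u.1 - h *: u.2) <= e * h.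
Proof.
case: u => x w /= [y [z [/= Cy Dz ->]]] Pq e0.
have [TC gC] := hC; have [TD gD] := hD.
have e4 : 0 < e / 4 by rewrite divr_gt0.
have [q' Pq' qq'] := lC0_bound hp TC Pq ler01.
have [_ qD qZ] := Psemi Pq.
move: Cy Dz; rewrite -gC -gD => /(generatorP hp) Cy /(generatorP hp) Dz.
near=> h; have h0 : 0 < h by near: h; exact: nbhs_right_gt.
have h1 : h <= 1 by near: h; exact: nbhs_right_le.
rewrite (hF (ltW h0)) /=.
have lC : rlinear (expC h : Xr -> Xr) by move=> r a b; exact: (linC (ltW h0)).
have -> : (expC h (expD h x) : Xr) - x - h *: ((y : Xr) + z) =
    (expC h : Xr -> Xr) ((expD h x : Xr) - x - h *: (z : Xr)) +
    (h *: ((expC h z : Xr) - z) + ((expC h x : Xr) - x - h *: (y : Xr))).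
  by rewrite !(rlinearB _ _ lC) (rlinearZ _ _ lC); lmod.
apply: le_trans (qD _ _) _; apply: le_trans (lerD (lexx _) (qD _ _)) _.
have b1 : q (expC h ((expD h x : Xr) - x - h *: (z : Xr))) <= e / 4 * h.
  apply: le_trans (qq' _ _ _) _; first by rewrite ltW.
  by near: h; exact: Dz.
have b2 : q (h *: ((expC h z : Xr) - z)) <= e / 4 * h.
  rewrite qZ gtr0_norm// mulrC ler_pM2r//.
  by near: h; exact: (lC0_cvg0 hp TC).
have b3 : q ((expC h x : Xr) - x - h *: (y : Xr)) <= e / 4 * h.
  by near: h; exact: Cy.
move: b1 b2 b3 (mulr_gt0 e0 h0); lra.
Unshelve. all: by end_near. Qed.

Let Gdense (x : Xr) (q : Xr -> R) (e : R) : P q -> 0 < e ->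
  exists2 u : Xr * Xr, G u & q (u.1 - x) <= e.
Proof.
move=> Pq e0.
have [y [[c Cc] [d Dd]] yx] := (dense_dominated hp _).1 densCD x q e Pq e0.
by exists (y, c + d) => //; exists c, d.
Qed.

Lemma sum_closable : closable G.
Proof.
have sG := sum_closure_subspace; split=> // x y z Gy Gz.
apply/eqP; rewrite -subr_eq0; apply/eqP/Psep => q Pq.
apply: (@graph_closure_functional _ Xr P F G Psemi Fl Feq product_derivative
  Gdense) => //.
rewrite -(closure_dominated hp).
have := sG.2 (-1) _ _ Gz Gy; rewrite scaleN1r; congr (closure _ _).
by apply/eqP; rewrite -pair_eqE /= addNr addrC !eqxx.
Qed.

Lemma product_formula_curve (v : R -> X) (s : R) :
  mild_solution (V := Xr) P G v -> left_continuous (V := Xr) P v ->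
  0 <= s -> product_limit (V := Xr) P F s (v 0) (v s).
Proof.
move=> vm vl s0 q e Pq e0.
exact: (chernoff Psemi Fl Feq product_derivative Gdense s0 Pq vm vl e0).
Qed.

Section Generation.
Variable (T : R -> X -> X).
Hypothesis HT : forall (s : R) (x : Xr), 0 <= s ->
  product_limit (V := Xr) P F s x (T s x).

Lemma limit_scalar_linear s : 0 <= s -> linear (T s).
Proof.
move=> s0 a x y.
rewrite (limitD Psemi Fl Psep HT (a *: x : Xr) y s0); congr (_ + _).
apply: (limit_comm Psemi Psep HT (A := fun z : Xr => a *: (z : X) : Xr)) => //.
- by move=> z w; rewrite scalerBr.
- move=> q Pq; have [c c0 qc] := seminorm_scale_bound X a.
  by exists (fun z => c * q z); [exact: dominatedZ|move=> z; apply: qc; case: Pq].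
- move=> h z h0; case: FE => FEl _ _; have [Fhl _] := FEl h h0.
  have := Fhl a z 0; rewrite (rlinear0 (Fl h0)) !addr0; exact.
Qed.

Lemma limit_seminorm_bound q (S : R) : P q -> 0 <= S ->
  exists2 q', P q' & forall s x, 0 <= s <= S -> q (T s x) <= q' x.
Proof.
move=> Pq S0; have [q' Pq' qq'] := Feq Pq S0; exists q' => // s x sS.
exact: (limit_bound Psemi HT _ Pq qq' sS).
Qed.

Lemma limit_lC0_semigroup : lC0_semigroup p T.
Proof.
have Tsemi := limit_semigroup Psemi Fl Feq product_derivative Gdense Psep HT.
have T0 : T 0 = id by apply/funext; exact: (limit0 Psemi Psep HT).
have TB s x y : 0 <= s -> T s (x - y) = T s x - T s y.
  move=> s0; have := limit_scalar_linear s0 (-1) y x.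
  by rewrite !scaleN1r ![- _ + _]addrC.
split=> //; last split=> //.
- apply/subspace_continuousP => s /=; rewrite in_itv /= andbT => s0.
  apply/pointwise_cvgP => x; apply/(cvg_dominated hp) => q e Pq e0.
  rewrite /from_subspace /=.
  have s10 : 0 <= s + 1 by rewrite addr_ge0.
  have [q' Pq' qq'] := limit_seminorm_bound Pq s10.
  have [t t0 tid] := limit_near_id Psemi Fl Feq product_derivative Gdense HT x Pq' e0.
  have sq := Psemi Pq.
  (* Factoring out T at the smaller time treats both sides of s at once, with one seminorm valid up
     to s + 1. *)
  have near_le a b : 0 <= a -> a <= s + 1 -> a <= b -> b - a <= t ->
      q (T b x - T a x) <= e.
    move=> a0 as1 ab bat.
    have -> : T b x = T a (T (b - a) x).
      by rewrite -Tsemi ?subr_ge0// addrC subrK.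
    rewrite -TB//; apply: le_trans (qq' _ _ _) _; first by rewrite a0.
    by apply: tid; rewrite subr_ge0 ab.
  rewrite nbhs_simpl /=; exists (Num.min 1 t) => /=; first by rewrite lt_min ltr01.
  move=> s' /=; rewrite lt_min => /andP[ss1 sst]; rewrite in_itv /= andbT => s'0.
  have [ss'|s's] := leP s s'.
    apply: near_le => //; first by rewrite lerDl.
    by apply: le_trans (ltW sst); rewrite distrC ler_norm.
  rewrite /= (rseminormBC _ _ sq); apply: near_le => //; last 2 first.
  - exact: ltW.
  - by apply: le_trans (ltW sst); rewrite ler_norm.
  by apply: le_trans (ltW s's) _; rewrite lerDl.
- by move=> l m l0 m0; apply/funext => x /=; exact: Tsemi.
- move=> s s0; split; first exact: limit_scalar_linear.
  move=> x; apply/(cvg_dominated hp) => q e Pq e0.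
  have [q' Pq' qq'] := limit_seminorm_bound Pq s0.
  apply: filterS (nbhs_seminorm_ball hp x Pq' e0) => y /= yx.
  by rewrite -TB//; apply: le_trans (qq' _ _ _) yx; rewrite s0 lexx.
- move=> S S0 a; have [q' [sq' [n [c [b [b0 qb]]]]] qq'] :=
    limit_seminorm_bound (dominated_generator hp a) S0.
  exists n, c, b; split=> // _ [N [m [d [N0 m0 d0 mdS ->]]]] x.
  have dN : 0 <= d / N%:R by rewrite divr_ge0.
  apply: le_trans (qb x).
  (* By the semigroup law powers of T are again values of T at times up to S, so the bound for T
     there suffices. *)
  have -> : iter m (T (d / N%:R)) x = T (m%:R * (d / N%:R)) x.
    elim: m {m0 mdS} => [|m IHm]; first by rewrite mul0r T0.
    have mdN : 0 <= m%:R * (d / N%:R) by rewrite mulr_ge0.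
    by rewrite iterS IHm -(Tsemi _ _ x dN mdN) -natr1 mulrDl mul1r addrC.
  by apply: qq'; rewrite mulr_ge0//= mulrA.
Qed.

(** The two inclusions between generator and closure are [limit_generator_sub] and
    [limit_derivative]. *)
Lemma limit_generates (A : set X) : dense A ->
  (forall f (s : R), A f -> 0 <= s -> exists w, closure G (T s f, w)) ->
  generates p (closure G) T.
Proof.
move=> dA AG; split; first exact: limit_lC0_semigroup.
have [G0 GL] := sum_closure_subspace.
move: AG G0 GL; rewrite (closure_dominated hp) => AG G0 GL.
apply/seteqP; split=> u.
  move=> /(generatorP hp) Tu.
  apply: (limit_generator_sub Psemi Fl Feq product_derivative Gdense Psep HT G0
    _ _ AG Tu).
    by move=> r v w; exact: GL.
  exact/(dense_dominated hp).
move=> Gu; apply/(generatorP hp) => q e Pq e0.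
have [t t0 tu] := limit_derivative Psemi Fl Feq product_derivative Gdense HT Gu Pq e0.
near=> h; apply: tu; apply/andP; split; near: h.
  exact: nbhs_right_gt.
exact: nbhs_right_le.
Unshelve. all: by end_near. Qed.

End Generation.

(** On the domain of the sum the orbits of T solve the equation, so the iterates follow them; bounds
    for the iterates and for T(s) extend this to all x. *)
Lemma generated_product_limit (T : R -> X -> X) :
  generates p (closure G) T ->
  forall (x : X) (s : R), 0 <= s -> product_limit (V := Xr) P F s x (T s x).
Proof.
move=> [TE gT] x s s0 q e Pq e0.
have sq := Psemi Pq; have [q0 qD qZ] := sq.
have e4 : 0 < e / 4 by rewrite divr_gt0.
have [q1 Pq1 qq1] := Feq Pq s0; have [q2 Pq2 qq2] := lC0_bound hp TE Pq s0.
have [u Gu ux] := Gdense x (dominatedD Pq1 Pq2) e4.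
have Tu : generator T u by rewrite gT; exact: subset_closure.
have := @product_formula_curve (fun s => T s u.1) s
  (lC0_mild_solution hp TE (esym gT) (_ : generator T (u.1, u.2)))
  (lC0_left_continuous hp TE u.1) s0 q _ Pq e4.
rewrite -surjective_pairing => /(_ Tu).
have -> : T 0 u.1 = u.1 by case: TE => _ ->.
move=> cu.
near=> h; have h0 : 0 < h by near: h; exact: nbhs_right_gt.
have Fh := Fl (ltW h0).
have cuh : q ((iter (steps s h) (F h) u.1 : Xr) - T s u.1) <= e / 4.
  by near: h; exact: cu.
have -> : (iter (steps s h) (F h) x : Xr) - T s x =
  - iter (steps s h) (F h : Xr -> Xr) (u.1 - x) +
   ((iter (steps s h) (F h) u.1 : Xr) - T s u.1 + T s (u.1 - x)).
  rewrite (rlinearB _ _ (rlinear_iter _ Fh)).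
  rewrite -[T s (u.1 - x)]/(T s ((u.1 : X) - x)) (lC0B TE)//.
  by lmod.
apply: le_trans (qD _ _) _; apply: le_trans (lerD (lexx _) (qD _ _)) _.
rewrite (rseminormN _ sq).
have := qq1 h _ (u.1 - x) (ltW h0) (steps_le s0 h0).
have : q (T s (u.1 - x)) <= q2 (u.1 - x) by apply: qq2; rewrite s0 lexx.
move: ux cuh; lra.
Unshelve. all: by end_near. Qed.

Lemma generated_product_formula (T : R -> X -> X) :
  generates p (closure G) T -> forall (f : X) (s : R), 0 < s ->
  iter n.+1 (F (s / n.+1%:R)) f @[n --> \oo] --> T s f.
Proof.
move=> gT f s s0; apply/(fmap_cvg_dominated hp) => q e Pq e0.
have := steplength_near (i := id) s0 (fun m n mn => mn)
  (generated_product_limit gT f (ltW s0) Pq e0).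
apply: filterS => n.
(* For h = s / (n + 1) the quotient s / h is an integer, so no rounding occurs. *)
have -> // : steps s (s / n.+1%:R) = n.+1.
by rewrite /steps invf_div mulrCA divff ?gt_eqF// mulr1 natrK.
Qed.

Section Approximation.
Variables (t : R) (A : set X).
Hypotheses (t0 : 0 < t) (sA : A `<=` dom C `&` dom D) (dA : dense A)
  (cA : approximation_conditions F (closure G) t A).

Lemma steps_scaled (s : R) n : Num.truncn (n.+1%:R * s / t) = steps s (t / n.+1%:R).
Proof. by rewrite /steps invf_div mulrA [s * _]mulrC. Qed.

Lemma approximation_solution f : A f -> exists v : R -> X,
  [/\ mild_solution (V := Xr) P G v, left_continuous (V := Xr) P v & v 0 = f].
Proof.
move=> Af; have [[c Cc] [d Dd]] := sA Af.
have Gf : G (f, c + d) by exists c, d.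
apply: (@mild_solution_exists _ Xr P F G Psemi Fl Feq product_derivative Gdense
  Psep Pcomplete f (c + d) t Gf t0).
  move=> s i s0 ii; have [g [_ _ cpt _]] := cA Af s0.
  have [j ij [l ul]] := cpt i ii; exists j => //; exists l => q e Pq e0.
  move: ul => /(fmap_cvg_dominated hp)/(_ q e Pq e0).
  by apply: filterS => n; rewrite /= steps_scaled.
(* Conditions (a) and (c) count [n s] steps of length t / n, hence run at time t s; they are used at
   s / t to match (b) at s. *)
move=> s i l s0 ii ul; have st0 : 0 <= s / t by rewrite divr_ge0// ltW.
have [g [gdom gw _ Zg]] := cA Af st0.
have [j ij [w Zw]] := Zg i ii.
exists w; rewrite -(closure_dominated hp).
pose u n := iter (steps s (t / n.+1%:R)) (F (t / n.+1%:R)) f.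
have uE n : iter (Num.truncn (n.+1%:R * (s / t))) (F (t / n.+1%:R)) f = u n.
  by rewrite mulrA steps_scaled.
have iij := increasing_seq_comp ii ij.
have ul' : u \o i @ \oo --> l.
  by apply/(fmap_cvg_dominated hp) => q e Pq e0; exact: ul.
(* The approximating pairs lie in the closure of [G] only, so the goal is first put as membership in
   the closure of that closure. *)
rewrite ((closure_id _).1 (@closed_closure _ G)).
apply: (closure_weak_limit hp sum_closure_subspace
  (u := g \o (i \o j)) (v := app (closure G) \o g \o (i \o j))).
- move=> n /=; have [y Gy] := gdom (i (j n)).
  by apply: (@xgetPex _ 0 [set y | closure G (_, y)]); exists y.
- move=> phi; have [phil phic] := proj2_sig phi.
  have phi0 : sval phi 0 = 0.
    have := phil (-1) 0 0; rewrite scaler0 addr0 => ->.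
    by rewrite scaleN1r addNr.
  have phiB a b : sval phi (a - b) = sval phi a - sval phi b.
    by have := phil (-1) b a; rewrite !scaleN1r ![- _ + _]addrC.
  have c1 : sval phi (u (i (j n))) @[n --> \oo] --> (sval phi l : (scalars R k)^o).
    by apply: weakly_cvg_dual; apply: cvg_weakly_cvg; 
    exact: (cvg_comp j (u \o i) (increasing_seq_cvg ij) ul').
  have c2 : sval phi (u (i (j n)) - g (i (j n))) @[n --> \oo] -->
      (sval phi 0 : (scalars R k)^o).
    apply: (cvg_comp (i \o j) (fun n => sval phi (u n - g n))
      (increasing_seq_cvg iij)).
    (* Condition (a) transfers the limit [l] of the orbit to [g], through g = u - (u - g). *)
    have := weakly_cvg_dual (phi := phi) gw.
    by under eq_fun do rewrite uE.
  rewrite (_ : (fun n => _) = fun n => sval phi (u (i (j n))) -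
      sval phi (u (i (j n)) - g (i (j n)))); last first.
    by apply/funext => n; rewrite /= phiB subKr.
  by have := cvgB c1 c2; rewrite phi0 subr0; exact.
- by move=> phi; exact: weakly_cvg_dual.
Qed.

Lemma approximation_generates : exists T, generates p (closure G) T.
Proof.
have sol f : A f -> forall s : R, 0 <= s ->
    exists2 l, product_limit (V := Xr) P F s f l & exists w, closure G (l, w).
  move=> /approximation_solution[v [vm vl v0]] s s0; exists (v s).
    by rewrite -v0; exact: product_formula_curve.
  by have [w vw _] := vm s s0; exists w; rewrite (closure_dominated hp).
have tot := product_limit_total Psemi Fl Feq Pcomplete.
have /choice[T HT] (sx : R * X) : exists l, 0 <= sx.1 ->
    product_limit (V := Xr) P F sx.1 sx.2 l.
  case: sx => s x /=; have [s0|s0] := leP 0 s; last by exists 0.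
  suff [l xl] : exists l, product_limit (V := Xr) P F s x l by exists l.
  apply: tot => // y q e Pq e0.
  have [f Af fy] := (dense_dominated hp _).1 dA y q e Pq e0.
  by exists f => // s' s'0; have [l fl _] := sol f Af s' s'0; exists l.
exists (fun s x => T (s, x)); apply: (limit_generates _ dA).
  by move=> s x s0; exact: (HT (s, x)).
move=> f s Af s0; have [l fl [w lw]] := sol f Af s s0.
by exists w; rewrite (product_limit_unique Psemi Psep (HT (s, f) s0) fl).
Qed.

End Approximation.

(** The constant sequence T(s t) f works: it stays in the domain of the generator, (c) is trivial
    for it, and (a) and (b) are the product formula at the times s t and s. *)
Lemma generated_approximation (t : R) (T : R -> X -> X) : 0 < t ->
  generates p (closure G) T ->
  approximation_conditions F (closure G) t (dom C `&` dom D).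
Proof.
move=> t0 gT f [[c Cc] [d Dd]] s s0.
have [TE gE] := gT.
have Gf : closure G (f, c + d) by apply: subset_closure; exists c, d.
have Tf (r : R) : 0 <= r -> closure G (T r f, T r (c + d)).
  move=> r0; rewrite -gE; apply: (lC0_generator_invariant hp TE r0).
  by rewrite gE.
have Flim (r : R) : 0 <= r ->
    (fun n => iter (steps r (t / n.+1%:R)) (F (t / n.+1%:R)) f) @ \oo --> T r f.
  move=> r0; apply/(fmap_cvg_dominated hp) => q e Pq e0.
  exact: (steplength_near (i := id) t0 (fun m n mn => mn)
    (generated_product_limit gT f r0 Pq e0)).
have st0 : 0 <= s * t by rewrite mulr_ge0// ltW.
exists (fun=> T (s * t) f); split.
- by move=> n; exists (T (s * t) (c + d)); exact: Tf.
- apply: cvg_weakly_cvg; apply/(fmap_cvg_dominated hp) => q e Pq e0.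
  have /(fmap_cvg_dominated hp)/(_ q e Pq e0) := Flim _ st0.
  apply: filterS => n /=; rewrite subr0.
  rewrite -steps_scaled.
  by rewrite mulrA mulfK ?gt_eqF.
- move=> i ii; exists id => //; exists (T s f).
  under eq_fun do rewrite steps_scaled.
  exact: (cvg_comp i _ (increasing_seq_cvg ii) (Flim s s0)).
- move=> i ii; exists id => //; exists (app (closure G) (T (s * t) f)).
  by apply: cvg_weakly_cvg; exact: cvg_cst.
Qed.

End Trotter.

Theorem corollary8p3 (R : realType) (k : scalar_kind)
  (X : tvsType (scalars R k)) (Omega : Type) (p : Omega -> X -> R)
  (hp : generating_seminorms p)
  (hausdorffX : hausdorff_space X) (completeX : complete_tvs X)
  (C D : set (X * X)) (expC expD : R -> X -> X)
  (hC : generates p C expC) (hD : generates p D expD)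
  (t : R) (ht : 0 < t)
  (F : R -> X -> X) (hF : forall s, 0 <= s -> F s = expC s \o expD s)
  (densCD : dense (dom C `&` dom D))
  (FE : class_E p F) :
  (closable (op_add C D) /\
     (exists T, generates p (closure (op_add C D)) T) <->
   exists A : set X,
     [/\ linear_subspace A, A `<=` dom C `&` dom D, dense A &
         approximation_conditions F (closure (op_add C D)) t A]) /\
  (forall A : set X,
     linear_subspace A -> A `<=` dom C `&` dom D -> dense A ->
     approximation_conditions F (closure (op_add C D)) t A ->
     forall T, generates p (closure (op_add C D)) T ->
     forall (f : X) (s : R), 0 < s ->
       iter n.+1 (F (s / n.+1%:R)) f @[n --> \oo] --> T s f).
Proof.
split; last first.
  move=> A _ _ _ _ T gT f s s0.
  exact: (generated_product_formula hp hC hD hF densCD FE gT).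
split=> [[_ [T gT]]|[A [_ sA dA cA]]].
  exists (dom C `&` dom D); split=> //; last first.
    exact: (generated_approximation hp hC hD hF densCD FE ht gT).
  case: hC hD => TC gC [TD gD]; rewrite -gC -gD.
  apply: dom_subspace; apply: (generator_subspace hp).
    exact: (lC0_linear TC).
  exact: (lC0_linear TD).
split.
  exact: (sum_closable hp hausdorffX hC hD hF densCD FE).
exact: (approximation_generates hp hausdorffX completeX hC hD hF densCD FE ht
  sA dA cA).
Qed.
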